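(* Let $\alpha\geq-\frac12$. For any $I\in\mathbb{S}$ and any $f\in\mathcal{F}^{\alpha}_{Slice}(\mathbb{H})$ we have $$T_\alpha D_\alpha^I T_\alpha^{-1}(f)(x)=f(-xI)\qquad\text{for all }x\in\mathbb{R}.$$
   Context: $\mathbb{H}$ is the skew field of quaternions, $\mathbb{S}=\{q\in\mathbb{H}: q^2=-1\}$, and $\mathbb{C}_I=\mathbb{R}+\mathbb{R}I$ for $I\in\mathbb{S}$. A function $f:\mathbb{H}\to\mathbb{H}$ is entire slice (left) regular if it is real differentiable and, for every $I\in\mathbb{S}$, its restriction $f_I$ to $\mathbb{C}_I$ has continuous partial derivatives and satisfies $\frac12(\partial_x+I\partial_y)f_I(x+yI)=0$; equivalently $f(q)=\sum_{n\ge 0}q^na_n$ with $a_n\in\mathbb{H}$, converging on all of $\mathbb{H}$. Put $f^e(q)=\frac{f(q)+f(-q)}2$, $f^o(q)=\frac{f(q)-f(-q)}2$. Let $\mathrm{Mac}_\alpha(x)=\int_0^\infty e^{-x\cosh t}\cosh(\alpha t)\,dt$ ($x>0$) be the Macdonald function and, for $I\in\mathbb{S}$, on $\mathbb{C}_I$ with Lebesgue measure $d\lambda_I$, let $$d\lambda_{\alpha,I}(p)=\frac{|p|^{2\alpha+2}}{\pi 2^\alpha\Gamma(\alpha+1)}\mathrm{Mac}_\alpha(|p|^2)\,d\lambda_I(p).$$ $\mathcal{F}^{\alpha}_{Slice}(\mathbb{H})$ is the right quaternionic Hilbert space of entire slice regular $f$ such that, for $I\in\mathbb{S}$ (the choice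 of $I$ is immaterial), $$\int_{\mathbb{C}_I}|f^e_I|^2d\lambda_{\alpha,I}+2(\alpha+1)\int_{\mathbb{C}_I}|f^o_I(p)|^2|p|^{-2}d\lambda_{\alpha+1,I}(p)<\infty,$$ with inner product $$\langle f,g\rangle=\int_{\mathbb{C}_I}\overline{g^e_I}f^e_I\,d\lambda_{\alpha,I}+2(\alpha+1)\int_{\mathbb{C}_I}\overline{g^o_I(p)}f^o_I(p)|p|^{-2}d\lambda_{\alpha+1,I}(p).$$ $\mathcal{H}_\alpha=L^2_{\mathbb{H}}(\mathbb{R},d\mu_\alpha)$ is the right quaternionic Hilbert space of $\mathbb{H}$-valued square integrable functions on $\mathbb{R}$ for $d\mu_\alpha(x)=\frac{|x|^{2\alpha+1}}{2^{\alpha+1}\Gamma(\alpha+1)}dx$. $\beta_n(\alpha)=2^n\left[\frac n2\right]!\,\frac{\Gamma\left(\left[\frac{n+1}{2}\right]+\alpha+1\right)}{\Gamma(\alpha+1)}$ ($[\cdot]$ the integer part). For $p\in\mathbb{H}$, $x\in\mathbb{R}$, $L_\alpha(px)=\sum_{n\ge0}\frac{p^nx^n}{\beta_n(\alpha)}$, and $\mathcal{C}_\alpha(p,x)=2^{\frac{\alpha+1}2}e^{-\frac12(p^2+x^2)}L_\alpha(\sqrt2\,px)$. $T_\alpha:\mathcal{H}_\alpha\to\mathcal{F}^{\alpha}_{Slice}(\mathbb{H})$, $T_\alpha\varphi(q)=\int_{\mathbb{R}}\mathcal{C}_\alpha(q,x)\varphi(x)d\mu_\alpha(x)$, is an isometric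 isomorphism onto $\mathcal{F}^{\alpha}_{Slice}(\mathbb{H})$. The (right) slice Dunkl transform with respect to $\mathbb{C}_I$ is $D_\alpha^I\varphi(x)=\int_{\mathbb{R}}L_\alpha(-Ixt)\varphi(t)\,d\mu_\alpha(t)$, where $L_\alpha(-Ixt)=\sum_{n\ge0}\frac{(-Ixt)^n}{\beta_n(\alpha)}$; by a Plancherel theorem it extends uniquely to a unitary operator of $\mathcal{H}_\alpha$ onto itself, and this extension is the meaning of $D_\alpha^I$ on $\mathcal{H}_\alpha$. *)

(* Defs.v *)
From HB Require Import structures.
From mathcomp Require Import all_boot all_order all_algebra.
From mathcomp Require Import all_classical all_reals all_analysis.
From mathcomp Require Import ring.

Set Implicit Arguments.
Unset Strict Implicit.
Unset Printing Implicit Defensive.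

Import Order.TTheory GRing.Theory Num.Theory.
Import numFieldNormedType.Exports.

Local Open Scope classical_set_scope.
Local Open Scope ring_scope.

(* The skew field of quaternions.  The row (a, b, c, d) stands for
   a + b i + c j + d k.  The topology and the differential calculus are those
   of 'rV[R]_4, so the library norm `|q| on this type is the sup norm of the
   coordinates; the Euclidean modulus is qnorm below. *)
Definition quat (R : realType) : Type := 'rV[R]_4.

HB.instance Definition _ (R : realType) :=
  NormedModule.copy (quat R) 'rV[R]_4.
HB.instance Definition _ (R : realType) := Complete.on (quat R).

Definition mkquat (R : realType) (a b c d : R) : quat R :=
  \row_(i < 4) [:: a; b; c; d]`_i.

Definition qc (R : realType) (n : nat) (q : quat R) : R := q ord0 (inord n).

Definition qone (R : realType) : quat R := mkquat 1 0 0 0.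

Definition qmul (R : realType) (p q : quat R) : quat R :=
  mkquat (qc 0 p * qc 0 q - qc 1 p * qc 1 q - qc 2 p * qc 2 q - qc 3 p * qc 3 q)
         (qc 0 p * qc 1 q + qc 1 p * qc 0 q + qc 2 p * qc 3 q - qc 3 p * qc 2 q)
         (qc 0 p * qc 2 q - qc 1 p * qc 3 q + qc 2 p * qc 0 q + qc 3 p * qc 1 q)
         (qc 0 p * qc 3 q + qc 1 p * qc 2 q - qc 2 p * qc 1 q + qc 3 p * qc 0 q).

Lemma qc_mkquat (R : realType) (a b c d : R) :
  (qc 0 (mkquat a b c d) = a) * (qc 1 (mkquat a b c d) = b) *
  (qc 2 (mkquat a b c d) = c) * (qc 3 (mkquat a b c d) = d).
Proof. by rewrite /qc /mkquat !mxE !inordK. Qed.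

Lemma quatP (R : realType) (p q : quat R) :
  qc 0 p = qc 0 q -> qc 1 p = qc 1 q -> qc 2 p = qc 2 q -> qc 3 p = qc 3 q ->
  p = q.
Proof.
move=> h0 h1 h2 h3; apply/rowP => i; rewrite -(inord_val i).
by case: i => -[|[|[|[|]]]] //= *.
Qed.

Lemma qcD (R : realType) n (p q : quat R) : qc n (p + q) = qc n p + qc n q.
Proof. by rewrite /qc mxE. Qed.

Lemma qmulA (R : realType) : associative (@qmul R).
Proof. by move=> p q r; apply: quatP; rewrite /qmul !qc_mkquat; ring. Qed.

Lemma qmul1q (R : realType) : left_id (@qone R) (@qmul R).
Proof. by move=> p; apply: quatP; rewrite /qmul /qone !qc_mkquat; ring. Qed.

Lemma qmulq1 (R : realType) : right_id (@qone R) (@qmul R).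
Proof. by move=> p; apply: quatP; rewrite /qmul /qone !qc_mkquat; ring. Qed.

Lemma qmulDl (R : realType) : left_distributive (@qmul R) +%R.
Proof.
by move=> p q r; apply: quatP; rewrite /qmul !(qcD, qc_mkquat); ring.
Qed.

Lemma qmulDr (R : realType) : right_distributive (@qmul R) +%R.
Proof.
by move=> p q r; apply: quatP; rewrite /qmul !(qcD, qc_mkquat); ring.
Qed.

Lemma qone_neq0 (R : realType) : @qone R != 0.
Proof.
apply/eqP => /(congr1 (qc 0)); rewrite /qone qc_mkquat /qc mxE => /eqP.
by rewrite oner_eq0.
Qed.

HB.instance Definition _ (R : realType) :=
  GRing.Zmodule_isNzRing.Build (quat R) (@qmulA R) (@qmul1q R) (@qmulq1 R)
    (@qmulDl R) (@qmulDr R) (@qone_neq0 R).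

Definition qreal (R : realType) (x : R) : quat R := x *: (1 : quat R).

Definition qconj (R : realType) (q : quat R) : quat R :=
  mkquat (qc 0 q) (- qc 1 q) (- qc 2 q) (- qc 3 q).

Definition qnorm (R : realType) (q : quat R) : R :=
  Num.sqrt (qc 0 q ^+ 2 + qc 1 q ^+ 2 + qc 2 q ^+ 2 + qc 3 q ^+ 2).

Definition qexp (R : realType) (q : quat R) : quat R :=
  limn (series (fun n => (n`!%:R)^-1 *: q ^+ n)).

Definition imaginary_unit (R : realType) : set (quat R) :=
  [set q | q ^+ 2 = - 1].

Definition slice_pt (R : realType) (J : quat R) (x y : R) : quat R :=
  qreal x + y *: J.

Section slice_regular.
Context {R : realType}.
Implicit Types (f : quat R -> quat R) (J : quat R).

Definition slice_dx f J (x y : R) : quat R :=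
  derive1 (fun s : R => f (slice_pt J s y)) x.

Definition slice_dy f J (x y : R) : quat R :=
  derive1 (fun s : R => f (slice_pt J x s)) y.

(* Total differentiability makes both partial derivatives exist, so the
   total operator derive1 above carries no junk value. *)
Definition entire_slice_regular f : Prop :=
  (forall q, differentiable f q) /\
  (forall J, imaginary_unit J ->
    [/\ continuous (fun z : R * R => slice_dx f J z.1 z.2),
        continuous (fun z : R * R => slice_dy f J z.1 z.2) &
        forall x y : R, 2^-1 *: (slice_dx f J x y + J * slice_dy f J x y) = 0]).

Definition even_part f (q : quat R) : quat R := 2^-1 *: (f q + f (- q)).

Definition odd_part f (q : quat R) : quat R := 2^-1 *: (f q - f (- q)).

End slice_regular.

Section special_functions.
Context {R : realType}.

Definition Gamma (a : R) : R :=
  \int[lebesgue_measure]_(t in `]0, +oo[) (t `^ (a - 1) * expR (- t)).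

Definition cosh (t : R) : R := (expR t + expR (- t)) / 2.

Definition Macdonald (alpha x : R) : R :=
  \int[lebesgue_measure]_(t in `[0, +oo[)
    (expR (- (x * cosh t)) * cosh (alpha * t)).

Definition beta_coef (alpha : R) (n : nat) : R :=
  2 ^+ n * (n./2)`!%:R * Gamma ((n.+1./2)%:R + alpha + 1) / Gamma (alpha + 1).

(* For real x, p ^ n x ^ n = (p x) ^ n, so L_alpha is a function of one
   quaternionic variable. *)
Definition L_dunkl (alpha : R) (q : quat R) : quat R :=
  limn (series (fun n => (beta_coef alpha n)^-1 *: q ^+ n)).

End special_functions.

Section fock_space.
Context {R : realType}.

(* Density of lambda_{alpha,I} with respect to Lebesgue measure on C_I, as a
   function of the modulus r = |p|. *)
Definition fock_density (alpha r : R) : R :=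
  r `^ (2 * alpha + 2) / (pi * 2 `^ alpha * Gamma (alpha + 1)) *
  Macdonald alpha (r ^+ 2).

(* Integral over C_I, with C_I identified with R * R by (x, y) |-> x + y I. *)
Definition slice_integral (J : quat R) (h : quat R -> R) : \bar R :=
  (\int[(lebesgue_measure \x lebesgue_measure)%E]_(z in [set: R * R])
     (h (slice_pt J z.1 z.2))%:E)%E.

Definition fock_sqnorm (alpha : R) (J : quat R) (f : quat R -> quat R)
    : \bar R :=
  (slice_integral J (fun p =>
     (qnorm (even_part f p)) ^+ 2 * fock_density alpha (qnorm p))%R +
   (2 * (alpha + 1))%:E *
   slice_integral J (fun p =>
     (qnorm (odd_part f p)) ^+ 2 * (qnorm p) ^- 2 *
       fock_density (alpha + 1) (qnorm p))%R)%E.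

Definition slice_fock (alpha : R) : set (quat R -> quat R) :=
  [set f | entire_slice_regular f /\
           forall J, imaginary_unit J -> (fock_sqnorm alpha J f < +oo)%E].

End fock_space.

Section L2_space.
Context {R : realType}.
Implicit Types (alpha : R) (phi psi : R -> quat R).

(* Density of mu_alpha with respect to Lebesgue measure.  It is positive off 0,
   so "mu_alpha-almost everywhere" and "Lebesgue-almost everywhere" agree. *)
Definition mu_density alpha (x : R) : R :=
  `|x| `^ (2 * alpha + 1) / (2 `^ (alpha + 1) * Gamma (alpha + 1)).

Definition mu_integral alpha phi : quat R :=
  \row_(i < 4) (\int[lebesgue_measure]_x (mu_density alpha x * phi x ord0 i)).

Definition quat_measurable phi : Prop :=
  forall i : 'I_4, measurable_fun [set: R] (fun x => phi x ord0 i).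

Definition L1_mu alpha : set (R -> quat R) :=
  [set phi | quat_measurable phi /\
    (\int[lebesgue_measure]_x (qnorm (phi x) * mu_density alpha x)%:E < +oo)%E].

Definition L2_mu alpha : set (R -> quat R) :=
  [set phi | quat_measurable phi /\
    (\int[lebesgue_measure]_x
       ((qnorm (phi x)) ^+ 2 * mu_density alpha x)%:E < +oo)%E].

Definition L2_dot alpha phi psi : quat R :=
  mu_integral alpha (fun x => qconj (psi x) * phi x).

Definition eq_ae phi psi : Prop :=
  {ae (@lebesgue_measure R), forall x, phi x = psi x}.

End L2_space.

Section transforms.
Context {R : realType}.
Implicit Types (alpha : R) (J : quat R).

Definition segal_bargmann_kernel alpha (p : quat R) (x : R) : quat R :=
  2 `^ ((alpha + 1) / 2) *:
  (qexp (- 2^-1 *: (p ^+ 2 + qreal (x ^+ 2))) *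
   L_dunkl alpha ((Num.sqrt 2 * x) *: p)).

Definition segal_bargmann alpha (phi : R -> quat R) (q : quat R) : quat R :=
  mu_integral alpha (fun x => segal_bargmann_kernel alpha q x * phi x).

(* Elements of H_alpha are represented by functions, so identities in H_alpha
   are almost everywhere equalities, whereas identities in the Fock space are
   pointwise. *)
Definition is_segal_bargmann_inverse alpha
    (S : (quat R -> quat R) -> (R -> quat R)) : Prop :=
  (forall g, slice_fock alpha g ->
     L2_mu alpha (S g) /\ forall q, segal_bargmann alpha (S g) q = g q) /\
  (forall phi, L2_mu alpha phi ->
     slice_fock alpha (segal_bargmann alpha phi) /\
     eq_ae (S (segal_bargmann alpha phi)) phi).

Definition dunkl_integral alpha J (phi : R -> quat R) (x : R) : quat R :=
  mu_integral alpha (fun t => L_dunkl alpha (- (x * t) *: J) * phi t).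

(* The unitary operators of a right quaternionic Hilbert space are the
   surjective right linear isometries. *)
Definition is_unitary alpha (D : (R -> quat R) -> (R -> quat R)) : Prop :=
  [/\ forall phi, L2_mu alpha phi -> L2_mu alpha (D phi),
      forall phi psi (a : quat R), L2_mu alpha phi -> L2_mu alpha psi ->
        eq_ae (D (fun x => phi x * a + psi x))
              (fun x => D phi x * a + D psi x),
      forall phi psi, L2_mu alpha phi -> L2_mu alpha psi ->
        L2_dot alpha (D phi) (D psi) = L2_dot alpha phi psi &
      forall psi, L2_mu alpha psi ->
        exists2 phi, L2_mu alpha phi & eq_ae (D phi) psi].

(* The slice Dunkl transform on H_alpha: the unitary operator given by the
   integral formula on the dense subspace of functions that are also
   mu_alpha-integrable (where that integral converges absolutely). *)
Definition is_slice_dunkl alpha J (D : (R -> quat R) -> (R -> quat R)) : Prop :=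
  is_unitary alpha D /\
  (forall phi, L1_mu alpha phi -> L2_mu alpha phi ->
     eq_ae (D phi) (dunkl_integral alpha J phi)).

End transforms.

(* Main.v *)
(** Write [psi t = C_alpha(x J, t)].  The kernel [C_alpha(x, .)] is real valued, and
    the Dunkl transform of [psi] is [C_alpha(x, .)]; since [D] is unitary,
      [T D phi (x) = <D phi, D psi> = <phi, psi> = T phi (- x J)],
    because [conj (psi t) = C_alpha(- x J, t)].
    The transform of [psi] is Weber's second exponential integral: splitting
    [L_alpha] into its even and odd parts, which are normalised Bessel functions
    [0F1(; alpha + 1; .)] and [0F1(; alpha + 2; .)], it reduces to
      [int |t|^(2b-1) e^(-t^2/2) 0F1(; b; u t^2) 0F1(; b; v t^2) dt
        = 2^b Gamma(b) e^(2u+2v) 0F1(; b; 4uv)].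
    Termwise integration turns the latter into the Chu-Vandermonde identity;
    monotone convergence at [|u|, |v|] supplies the dominating function for
    arbitrary [u, v]. *)
Require Import Defs.
From mathcomp Require Import all_boot all_order all_algebra.
From mathcomp Require Import all_classical all_reals all_analysis.
From mathcomp Require Import measurable_realfun ring lra.

Set Implicit Arguments.
Unset Strict Implicit.
Unset Printing Implicit Defensive.

Import Order.TTheory GRing.Theory Num.Theory.
Import numFieldNormedType.Exports.

Local Open Scope classical_set_scope.
Local Open Scope ring_scope.

(** The integral formula for [D] holds only on functions in both [L1_mu] and [L2_mu], whereas
    [Tinv f] is merely in [L2_mu], so the formula cannot be applied to it. The isometry moves the
    computation to the single explicit function [psi], and no double integral has to be
    interchanged. Since [L2_dot] conjugates its second argument, the transform of [psi] reproduces
    the kernel of [T] only because that transform is real valued. With [b = alpha + 1] the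
    hypothesis reads [1/2 <= b]: the exponent [2b - 1] is nonnegative, and the rising factorials of
    [b] stay at least 1/2. For [J^2 = -1] the parameters in Weber's integral are [u = - s^2 / 4] and
    [v = - x^2 / 2]. Both Bessel series alternate, but [4uv] is nonnegative: this sign change turns
    the kernel on the imaginary axis of the slice into the kernel at a real point. *)

Section pochhammer.
Context {R : realType}.
Implicit Types (b : R) (k m n : nat).

(** * Rising factorials and the Chu-Vandermonde identity *)

Definition poch b n : R := \prod_(i < n) (b + i%:R).

Lemma poch0 b : poch b 0 = 1.
Proof. by rewrite /poch big_ord0. Qed.

Lemma pochS b n : poch b n.+1 = poch b n * (b + n%:R).
Proof. by rewrite /poch big_ord_recr. Qed.

Lemma pochSl b n : poch b n.+1 = b * poch (b + 1) n.
Proof.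
rewrite /poch big_ord_recl addr0; congr (_ * _); apply: eq_bigr => i _.
by rewrite lift0 -addrA nat1r.
Qed.

Lemma poch_gt0 b n : 0 < b -> 0 < poch b n.
Proof. by move=> b0; apply: prodr_gt0 => i _; rewrite ltr_pwDl. Qed.

(** Every factor after the first one, [b], is at least 1. The bound is uniform in [n], so twice the
    exponential series dominates the Bessel series. *)
Lemma poch_ge_half b n : 2^-1 <= b -> 2^-1 <= poch b n.
Proof.
move=> hb; case: n => [|n]; first by rewrite poch0; lra.
elim: n => [|n IH]; first by rewrite pochS poch0 mul1r addr0.
rewrite pochS -[leLHS]mulr1 ler_pM ?invr_ge0//.
have : (1 : R) <= n.+1%:R by rewrite ler1n.
by lra.
Qed.

(** This is the value of [2F1(-m, -n; b; 1)]. Pascal's rule splits the sum for [m + 1] into the sum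
    for [(b, m, n)] and [n / b] times the sum for [(b + 1, m, n - 1)]; hence the induction keeps [b]
    and [n] general. *)
Lemma chu_vandermonde b m n : 0 < b ->
  \sum_(l < m.+1) ('C(m, l) * n ^_ l)%:R / poch b l =
  poch b (m + n) / (poch b m * poch b n).
Proof.
elim: m b n => [|m IH] b n b0.
  rewrite big_ord1 !poch0 mul1r bin0 ffactn0 divr1 add0n divff//.
  by rewrite gt_eqF// poch_gt0.
have nz c k : 0 < c -> poch c k != 0 by move=> c0; rewrite gt_eqF// poch_gt0.
have bS0 : 0 < b + 1 by rewrite addr_gt0.
have -> : \sum_(l < m.+2) ('C(m.+1, l) * n ^_ l)%:R / poch b l =
    \sum_(l < m.+1) ('C(m, l) * n ^_ l)%:R / poch b l +
    \sum_(l < m.+1) ('C(m, l) * n ^_ l.+1)%:R / poch b l.+1.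
  rewrite big_ord_recl/= bin0 [X in _ = X + _]big_ord_recl/= bin0 -addrA.
  congr (_ + _).
  under eq_bigr do rewrite /bump/= add1n binS mulnDl natrD mulrDl.
  rewrite big_split/=; congr (_ + _).
  by rewrite big_ord_recr/= bin_small// mul0n mul0r addr0.
rewrite IH//.
case: n => [|n].
  rewrite big1 => [|i _]; last by rewrite ffact0n muln0 mul0r.
  by rewrite addr0 !addn0 !poch0 !mulr1 !divff ?nz.
have -> : \sum_(l < m.+1) ('C(m, l) * n.+1 ^_ l.+1)%:R / poch b l.+1 =
    (n.+1%:R / b) * \sum_(l < m.+1) ('C(m, l) * n ^_ l)%:R / poch (b + 1) l.
  rewrite mulr_sumr; apply: eq_bigr => l _.
  rewrite ffactSS pochSl mulnCA natrM; field.
  by rewrite (gt_eqF b0) nz.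
rewrite IH// addSn addnS !(pochS b (m + n).+1).
have bm : b * poch (b + 1) m = poch b m * (b + m%:R) by rewrite -pochSl pochS.
have -> : poch (b + 1) m = poch b m * (b + m%:R) / b.
  by rewrite -bm mulrAC divff ?mul1r// gt_eqF.
have -> : poch (b + 1) n = poch b n.+1 / b.
  by rewrite pochSl mulrAC divff ?mul1r// gt_eqF.
have -> : poch (b + 1) (m + n) = poch b (m + n).+1 / b.
  by rewrite pochSl mulrAC divff ?mul1r// gt_eqF.
rewrite (pochS b m) -!natr1 natrD.
have bm0 : b + m%:R != 0 by rewrite gt_eqF// ltr_pwDl.
by field; rewrite bm0 (gt_eqF b0) !nz.
Qed.

(** Against [U^m V^n] the [l]-th term gives [U^(m-l) V^(n-l) (UV)^l], which is how the coefficients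
    of [e^U e^V 0F1(; b; UV)] arise. *)
Lemma poch_product_formula b m n : 0 < b ->
  poch b (m + n) / (m`!%:R * n`!%:R * poch b m * poch b n) =
  \sum_(l < m.+1 | (l <= n)%N)
     ((m - l)`!%:R)^-1 * ((n - l)`!%:R)^-1 * (l`!%:R * poch b l)^-1.
Proof.
move=> b0.
have nz c k : 0 < c -> poch c k != 0 by move=> c0; rewrite gt_eqF// poch_gt0.
have fz k : (k`!%:R : R) != 0 by rewrite pnatr_eq0 -lt0n fact_gt0.
transitivity (\sum_(l < m.+1) ('C(m, l) * n ^_ l)%:R / poch b l / (m`!%:R * n`!%:R)).
  rewrite -mulr_suml chu_vandermonde//; field.
  by rewrite !fz !nz.
rewrite big_mkcond [RHS]big_mkcond/=; apply: eq_bigr => -[l /=]; rewrite ltnS => lm _.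
have [ln|nl] := leqP l n; last by rewrite ffact_small// muln0 !mul0r.
rewrite natrM -(ffact_fact ln) -(bin_fact lm) !natrM.
have bz : ('C(m, l)%:R : R) != 0 by rewrite pnatr_eq0 -lt0n bin_gt0.
have az : ((n ^_ l)%:R : R) != 0 by rewrite pnatr_eq0 -lt0n ffact_gt0.
by field; rewrite !fz bz az nz.
Qed.

End pochhammer.

(** * Normalised Bessel series and the partial sums of Weber's integral *)

Section bessel.
Context {R : realType}.
Implicit Types (b z U V : R) (k m n : nat).

Definition bessel_coeff b z : R ^nat :=
  fun k => z ^+ k / (k`!%:R * poch b k).

(* The normalised Bessel function [0F1(; b; z)]. *)
Definition bessel b z : R := limn (series (bessel_coeff b z)).

Lemma bessel_coeff_ge0 b z k : 0 < b -> 0 <= z -> 0 <= bessel_coeff b z k.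
Proof.
by move=> b0 z0; rewrite divr_ge0 ?exprn_ge0// mulr_ge0// ltW// poch_gt0.
Qed.

Lemma norm_bessel_coeff b z k : 0 < b ->
  `|bessel_coeff b z k| = bessel_coeff b `|z| k.
Proof.
move=> b0; rewrite /bessel_coeff normrM normfV normrX [`|_ * poch _ _|]ger0_norm//.
by rewrite mulr_ge0// ltW// poch_gt0.
Qed.

Lemma is_cvg_normed_bessel b z : 2^-1 <= b ->
  cvgn [normed series (bessel_coeff b z)].
Proof.
move=> hb; have b0 : 0 < b by lra.
rewrite (_ : [normed series _] = series (bessel_coeff b `|z|)); last first.
  by apply/funext => n; apply: eq_bigr => k _ /=; rewrite norm_bessel_coeff.
apply: (@series_le_cvg _ _ (2 \*: exp_coeff `|z|)).
- by move=> n; exact: bessel_coeff_ge0.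
- by move=> n; rewrite /= mulr_ge0// /exp_coeff mulr_ge0// exprn_ge0.
- move=> n; rewrite /= /exp_coeff /bessel_coeff.
  change (`|z| ^+ n / (n`!%:R * poch b n) <= 2 * (`|z| ^+ n / n`!%:R)).
  rewrite mulrCA ler_wpM2l ?exprn_ge0// invfM mulrC ler_wpM2r ?invr_ge0//.
  rewrite -[leRHS]invrK lef_pV2 ?posrE ?poch_gt0// ?invr_gt0//.
  exact: poch_ge_half.
- by apply: is_cvg_seriesZ; exact: is_cvg_series_exp_coeff.
Qed.

Lemma is_cvg_bessel b z : 2^-1 <= b -> cvgn (series (bessel_coeff b z)).
Proof. by move=> hb; apply: normed_cvg; exact: is_cvg_normed_bessel. Qed.

Lemma nondecreasing_bessel b z : 0 < b -> 0 <= z ->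
  nondecreasing_seq (series (bessel_coeff b z)).
Proof.
move=> b0 z0; apply/nondecreasing_seqP => n.
by rewrite !seriesEnat/= big_nat_recr//= lerDl bessel_coeff_ge0.
Qed.

Lemma bessel_partial_le b z n : 2^-1 <= b ->
  `|series (bessel_coeff b z) n| <= series (bessel_coeff b `|z|) n.
Proof.
move=> hb; have b0 : 0 < b by lra.
rewrite !seriesEnat/=; apply: le_trans (ler_norm_sum _ _ _) _.
by apply: ler_sum => i _; rewrite norm_bessel_coeff.
Qed.

Lemma bessel_partial_le_lim b z n : 2^-1 <= b -> 0 <= z ->
  series (bessel_coeff b z) n <= bessel b z.
Proof.
move=> hb z0; have b0 : 0 < b by lra.
by apply: nondecreasing_cvgn_le; [exact: nondecreasing_bessel|exact: is_cvg_bessel].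
Qed.

Lemma bessel_ge0 b z : 2^-1 <= b -> 0 <= z -> 0 <= bessel b z.
Proof.
move=> hb z0; apply: le_trans (bessel_partial_le_lim 0 hb z0).
by rewrite seriesEnat/= big_geq.
Qed.

(* Up to the factor [2^b Gamma(b)], the integral of [|t|^(2b-1) e^(-t^2/2)] times
   the product of the [K]-th partial sums of [bessel b (U t^2 / 2)] and
   [bessel b (V t^2 / 2)]. *)
Definition weber_partial b U V K : R :=
  \sum_(0 <= m < K) \sum_(0 <= n < K)
    U ^+ m * V ^+ n * (poch b (m + n) / (m`!%:R * n`!%:R * poch b m * poch b n)).

(** For fixed [l], the indices [m - l] and [n - l] run independently below [K - l], so the double
    sum factors into two exponential partial sums. Their length depends on [l], which is why the
    limit in [K] needs an argument. *)
Lemma weber_partialE b U V K : 0 < b ->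
  weber_partial b U V K = \sum_(0 <= l < K) bessel_coeff b (U * V) l *
     (series (exp_coeff U) (K - l)%N * series (exp_coeff V) (K - l)%N).
Proof.
move=> b0.
have shift (W : R) l : (l < K)%N ->
    series (exp_coeff W) (K - l)%N =
    \sum_(0 <= m < K | (l <= m)%N) W ^+ (m - l) / (m - l)`!%:R.
  move=> lK; rewrite seriesEnat/= [RHS](big_cat_nat _ (n := l)) ?(ltnW lK)//=.
  rewrite [X in _ = X + _]big_nat_cond [X in _ = X + _]big_pred0 ?add0r//; last first.
    by move=> i; rewrite [(l <= i)%N]leqNgt /=; case: (i < l)%N.
  rewrite [RHS](big_addn 0 K l) [RHS]big_mkcond/=.
  by apply: eq_bigr => i _; rewrite leq_addl addnK.
rewrite /weber_partial.
under [RHS]eq_big_nat => l lK do rewrite shift// shift//.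
(* An indicator of [l <= m] and [l <= n] makes the three ranges independent, so the sums can be
   exchanged. *)
transitivity (\sum_(0 <= m < K) \sum_(0 <= n < K) \sum_(0 <= l < K)
  if (l <= m)%N && (l <= n)%N then
     bessel_coeff b (U * V) l * (U ^+ (m - l) / (m - l)`!%:R *
        (V ^+ (n - l) / (n - l)`!%:R)) else 0).
  apply: eq_big_nat => m /= mK; apply: eq_big_nat => n /= nK.
  rewrite poch_product_formula// mulr_sumr.
  rewrite -(big_mkord (fun l => (l <= n)%N) (fun l => U ^+ m * V ^+ n *
    (((m - l)`!%:R)^-1 * ((n - l)`!%:R)^-1 * (l`!%:R * poch b l)^-1))).
  rewrite [RHS](big_cat_nat _ (n := m.+1))//= [X in _ + X]big_nat_cond.
  rewrite [X in _ + X]big1 ?addr0; last first.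
    by move=> l; rewrite andbT => /andP[ml _]; rewrite leqNgt ml.
  rewrite big_mkcond/=; apply: eq_big_nat => l; rewrite ltnS => /= lm.
  rewrite lm/=; case: ifP => // ln.
  rewrite -{1}(subnK lm) -{1}(subnK ln) !exprD /bessel_coeff exprMn !invfM.
  by ring.
under [LHS]eq_bigr => m _ do rewrite exchange_big/=.
rewrite exchange_big/=; apply: eq_bigr => l _.
rewrite big_distrlr/= mulr_sumr [RHS]big_mkcond/=; apply: eq_bigr => m _.
rewrite mulr_sumr; case: leqP => lm /=; last by rewrite big1.
by rewrite -big_mkcond.
Qed.

End bessel.

Lemma cvg_half : (fun n : nat => n./2) @ \oo --> \oo.
Proof.
move=> P [N _ NP]; exists N.*2 => // n /= Nn; apply: NP => /=.
by rewrite -(doubleK N) half_leq.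
Qed.

(** * Convergence of the truncated double sums *)

Section weber_partial_limit.
Context {R : realType}.
Implicit Types (b U V : R) (k l n K : nat).

Lemma exp_partial_norm_le U k n : (k <= n)%N ->
  `|series (exp_coeff U) n - series (exp_coeff U) k| <=
  series (exp_coeff `|U|) n - series (exp_coeff `|U|) k.
Proof.
move=> kn; rewrite !sub_series_geq//.
apply: le_trans (ler_norm_sum _ _ _) _; apply: ler_sum => i _.
by rewrite /exp_coeff/= normrM normfV normrX [`|_%:R|]ger0_norm.
Qed.

Lemma exp_partial_ge0 U n : 0 <= U -> 0 <= series (exp_coeff U) n.
Proof. by move=> U0; rewrite seriesEnat/= sumr_ge0// => i _; exact: exp_coeff_ge0. Qed.

Lemma exp_partial_abs U n : `|series (exp_coeff U) n| <= series (exp_coeff `|U|) n.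
Proof.
have := exp_partial_norm_le U (leq0n n).
by rewrite !seriesEnat/= !(big_geq (leqnn 0)) !subr0.
Qed.

Let expprod U V n := series (exp_coeff U) n * series (exp_coeff V) n.

Let expprod_norm_le U V k n : (k <= n)%N ->
  `|expprod U V n - expprod U V k| <= expprod `|U| `|V| n - expprod `|U| `|V| k.
Proof.
move=> kn; rewrite /expprod.
set un := series (exp_coeff U) n; set uk := series (exp_coeff U) k.
set vn := series (exp_coeff V) n; set vk := series (exp_coeff V) k.
set Un := series (exp_coeff `|U|) n; set Uk := series (exp_coeff `|U|) k.
set Vn := series (exp_coeff `|V|) n; set Vk := series (exp_coeff `|V|) k.
rewrite (_ : un * vn - uk * vk = (un - uk) * vn + uk * (vn - vk)); last by ring.
rewrite (_ : Un * Vn - _ = (Un - Uk) * Vn + Uk * (Vn - Vk)); last by ring.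
by rewrite (le_trans (ler_normD _ _))// !normrM lerD// ler_pM//
  ?exp_partial_norm_le// exp_partial_abs.
Qed.

(* [weber_partial] is the sum of [c_l U^(i+l) V^(j+l) / (i! j!)] over the [i, j, l]
   with [i + l, j + l < K]; [boxsum] is the same sum over the box [i, j, l < K]. *)
Let boxsum b U V K := series (bessel_coeff b (U * V)) K * expprod U V K.

Let boxsum_sub b U V K : 0 < b -> boxsum b U V K - weber_partial b U V K =
  \sum_(0 <= l < K) bessel_coeff b (U * V) l *
    (expprod U V K - expprod U V (K - l)%N).
Proof.
move=> b0; rewrite weber_partialE// /boxsum seriesEnat/= mulr_suml -sumrB.
by apply: eq_bigr => l _; rewrite mulrBr.
Qed.

(** The gap consists of products of coefficients whose absolute values are those at [|U|], [|V|];
    this reduces arbitrary signs to the nonnegative case. *)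
Let boxsum_norm_le b U V K : 0 < b ->
  `|boxsum b U V K - weber_partial b U V K| <=
  boxsum b `|U| `|V| K - weber_partial b `|U| `|V| K.
Proof.
move=> b0; rewrite !boxsum_sub//; apply: le_trans (ler_norm_sum _ _ _) _.
apply: ler_sum => l _; rewrite normrM norm_bessel_coeff// normrM.
rewrite ler_wpM2l ?expprod_norm_le ?leq_subr//.
by rewrite bessel_coeff_ge0// mulr_ge0.
Qed.

Let cvg_boxsum b U V : 2^-1 <= b ->
  boxsum b U V @ \oo --> bessel b (U * V) * (expR U * expR V).
Proof.
move=> hb; apply: cvgM; first exact: is_cvg_bessel.
by apply: cvgM; exact: is_cvg_series_exp_coeff.
Qed.

(** If [i], [j], [l] are below [K/2], then [i + l] and [j + l] are below [K]: the index region lies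
    between two boxes. *)
Let weber_partial_ge b U V K : 0 < b -> 0 <= U -> 0 <= V ->
  boxsum b U V K./2 <= weber_partial b U V K <= boxsum b U V K.
Proof.
move=> b0 U0 V0; apply/andP; split; last first.
  rewrite -subr_ge0; have := boxsum_norm_le U V K b0.
  by rewrite (ger0_norm U0) (ger0_norm V0); exact: le_trans.
have nd (W : R) k n : 0 <= W -> (k <= n)%N ->
    series (exp_coeff W) k <= series (exp_coeff W) n.
  move=> W0 kn; rewrite -subr_ge0; have := exp_partial_norm_le W kn.
  by rewrite (ger0_norm W0); exact: le_trans.
rewrite weber_partialE// /boxsum seriesEnat/= mulr_suml.
have K2 : (K./2 <= K)%N by rewrite leq_half_double -addnn -addnS leq_addr.
rewrite [leRHS](big_cat_nat _ (n := K./2))//= ler_wpDr//.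
  apply: sumr_ge0 => l _; rewrite mulr_ge0 ?bessel_coeff_ge0 ?mulr_ge0//;
  exact: exp_partial_ge0.
rewrite big_nat_cond [leRHS]big_nat_cond; apply: ler_sum => l.
rewrite andbT => /andP[_ lK].
have h : (K./2 <= K - l)%N.
  rewrite leq_subRL; last by rewrite (leq_trans (ltnW lK)).
  rewrite -[leqRHS](odd_double_half K) -addnn.
  by rewrite (leq_trans _ (leq_addl _ _))// leq_add2r ltnW.
rewrite ler_wpM2l ?bessel_coeff_ge0 ?mulr_ge0//.
by rewrite /expprod ler_pM ?exp_partial_ge0// nd.
Qed.

(** Squeezing between boxes settles [|U|], [|V|], so the gap to the box sum tends to 0 there, and
    therefore also at [U], [V]. *)
Lemma cvg_weber_partial b U V : 2^-1 <= b ->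
  weber_partial b U V @ \oo --> bessel b (U * V) * (expR U * expR V).
Proof.
move=> hb; have b0 : 0 < b by lra.
have pos : weber_partial b `|U| `|V| @ \oo -->
    bessel b (`|U| * `|V|) * (expR `|U| * expR `|V|).
  apply: (@squeeze_cvgr _ _ _ _ (fun n => boxsum b `|U| `|V| n./2)
     (boxsum b `|U| `|V|)).
  - by apply: nearW => K; exact: weber_partial_ge.
  - apply: (cvg_comp (fun n => n./2) (boxsum b `|U| `|V|) cvg_half); exact: cvg_boxsum.
  - exact: cvg_boxsum.
have h0 : boxsum b `|U| `|V| n - weber_partial b `|U| `|V| n @[n --> \oo] --> 0.
  rewrite -(subrr (bessel b (`|U| * `|V|) * (expR `|U| * expR `|V|))).
  by apply: cvgB => //; exact: cvg_boxsum.
have h1 : boxsum b U V n - weber_partial b U V n @[n --> \oo] --> 0.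
  apply: norm_cvg0; apply: squeeze_cvgr (@cvg_cst _ 0 _ _ _) h0.
  by apply: nearW => K; rewrite normr_ge0 boxsum_norm_le.
rewrite (_ : weber_partial b U V = boxsum b U V \-
    (fun n => boxsum b U V n - weber_partial b U V n)); last first.
  by apply/funext => n /=; rewrite subKr.
rewrite -[X in _ --> X]subr0; apply: cvgB h1; exact: cvg_boxsum.
Qed.

End weber_partial_limit.

(** * The substitution [u = t^2 / 2] in the Gamma integral *)

Section gaussian_moments.
Context {R : realType}.
Local Notation mu := (@lebesgue_measure R).
Implicit Types (b p t : R).

Definition gaussian_power p t : R := t `^ p * expR (- (t ^+ 2 / 2)).

Lemma gaussian_power_ge0 p t : 0 <= gaussian_power p t.
Proof. by rewrite mulr_ge0 ?powR_ge0 ?expR_ge0. Qed.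

Lemma measurable_gaussian_power p : measurable_fun [set: R] (gaussian_power p).
Proof.
apply: measurable_funM; first exact: measurable_powR.
apply: measurableT_comp => //; apply: measurableT_comp => //.
by apply: measurable_funM => //; exact: measurable_funX.
Qed.

Lemma derive_half_sqr : derive1 (fun t : R => t ^+ 2 / 2) = id.
Proof.
apply/funext => t; rewrite derive1E.
rewrite (_ : (fun _ => _) = (fun t : R => 2^-1 *: (t ^+ 2))); last first.
  by apply/funext => s; rewrite mulrC.
by rewrite deriveZ//= derive_val/= /GRing.scale/=; field.
Qed.

Lemma derivable_half_sqr t : derivable (fun t : R => t ^+ 2 / 2) t 1.
Proof. exact: derivableM. Qed.

(** Stated on compact intervals away from 0, since [u^(b-1)] may be singular there; exhausting the
    half-line recovers the full integral. *)
Lemma gamma_substitution_itv b (a c : R) : 0 < a -> a < c ->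
  (\int[mu]_(u in `[(a ^+ 2 / 2)%R, (c ^+ 2 / 2)%R]) (u `^ (b - 1) * expR (- u))%R%:E =
   \int[mu]_(t in `[a, c]) (2 `^ (1 - b) * gaussian_power (2 * b - 1) t)%R%:E)%E.
Proof.
move=> a0 ac.
rewrite (@integration_by_substitution_increasing _ (fun t : R => t ^+ 2 / 2)
  (fun u => u `^ (b - 1) * expR (- u))).
- apply: eq_integral => t; rewrite inE/= in_itv/= => /andP[at_ _].
  have t0 : 0 < t by rewrite (lt_le_trans a0).
  have powt : (t ^+ 2 / 2) `^ (b - 1) * t = 2 `^ (1 - b) * t `^ (2 * b - 1).
    have -> : t ^+ 2 / 2 = (t `^ 2%:R) * 2 `^ (-1).
      by rewrite powR_mulrn ?ltW// powR_inv1.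
    rewrite powRM ?powR_ge0// -!powRrM mulN1r opprB mulrAC mulrC; congr (_ * _).
    rewrite -[X in _ * X](powRr1 (ltW t0)) -powRD; last by rewrite (gt_eqF t0) implybT.
    by congr (_ `^ _); ring.
  congr EFin; rewrite derive_half_sqr /gaussian_power/=.
  by rewrite -[LHS]/((t ^+ 2 / 2) `^ (b - 1) * expR (- (t ^+ 2 / 2)) * t) mulrAC powt mulrA.
- exact: ltW.
- move=> x y; rewrite !in_itv/= => /andP[ax _] /andP[ay _] xy.
  by rewrite ltr_pM2r ?invr_gt0// ltr_pXn2r// nnegrE ltW// (lt_le_trans a0).
- by rewrite derive_half_sqr => x _; exact: cvg_id.
- rewrite derive_half_sqr; apply/cvg_ex; exists a.
  by apply: cvg_at_right_filter; exact: cvg_id.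
- rewrite derive_half_sqr; apply/cvg_ex; exists c.
  by apply: cvg_at_left_filter; exact: cvg_id.
- have cF : continuous (fun t : R => t ^+ 2 / 2).
    by move=> x; apply/differentiable_continuous/derivable1_diffP/derivable_half_sqr.
  split.
  + by move=> x _; exact: derivable_half_sqr.
  + by apply: cvg_at_right_filter; exact: cF.
  + by apply: cvg_at_left_filter; exact: cF.
- apply: derivable_within_continuous => u; rewrite in_itv/= => /andP[au _].
  have u0 : 0 < u by rewrite (lt_le_trans _ au)// divr_gt0// exprn_gt0.
  apply: derivableM; first by apply: derivable_powR; rewrite in_itv/= u0.
  apply: diff_derivable; apply: differentiable_comp => //.
  exact/derivable1_diffP/derivable_expR.
Qed.

Let cover_itv (g h : R ^nat) : nonincreasing_seq g -> nondecreasing_seq h ->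
  (forall n, 0 < g n) -> (forall x, 0 < x -> exists n, g n <= x <= h n) ->
  nondecreasing_seq (fun n => `[g n, h n]%classic : set R) /\
  \bigcup_n `[g n, h n]%classic = `]0, +oo[%classic.
Proof.
move=> dg ih g0 cov; split.
  move=> m n mn; apply/subsetPset => x/=; rewrite !in_itv/= => /andP[gx xh].
  by rewrite (le_trans (dg _ _ mn) gx) (le_trans xh (ih _ _ mn)).
apply/seteqP; split => [x [n _]|x]/=; rewrite !in_itv/=.
  by move=> /andP[gx _]; rewrite andbT (lt_le_trans (g0 n)).
by rewrite andbT => /cov[n gxh]; exists n => //=; rewrite in_itv.
Qed.

Lemma gamma_substitution b :
  (\int[mu]_(u in `]0%R, +oo[) (u `^ (b - 1) * expR (- u))%R%:E =
   \int[mu]_(t in `[0%R, +oo[) (2 `^ (1 - b) * gaussian_power (2 * b - 1) t)%R%:E)%E.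
Proof.
(* Starting at 2 rather than 1 gives [g n < h n] also for [n = 0], as the substitution requires. *)
pose g n : R := (n.+2%:R)^-1; pose h n : R := n.+2%:R.
have g0 n : 0 < g n by rewrite invr_gt0.
have gh n : g n < h n.
  by rewrite (@lt_trans _ _ 1)// ?ltr1n// invf_lt1// ltr1n.
have dg : nonincreasing_seq g.
  by move=> m n mn; rewrite /g lef_pV2 ?posrE// ler_nat.
have ih : nondecreasing_seq h by move=> m n mn; rewrite ler_nat.
have cov (x : R) : 0 < x -> exists n, g n <= x <= h n.
  move=> x0; exists (Num.truncn (x + x^-1)); apply/andP; split.
    rewrite /g -[leRHS]invrK lef_pV2 ?posrE ?invr_gt0//.
    rewrite (@le_trans _ _ (x + x^-1)) ?lerDr ?ltW//.
    by rewrite (lt_trans (truncnS_gt _))// ltr_nat.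
  rewrite (@le_trans _ _ (x + x^-1)) ?lerDl ?invr_ge0 ?ltW//.
  by rewrite (lt_trans (truncnS_gt _))// ltr_nat.
pose q (x : R) := x ^+ 2 / 2.
have qle x y : 0 <= x -> x <= y -> q x <= q y.
  by move=> x0 xy; rewrite ler_pM2r ?invr_gt0// lerXn2r// nnegrE// (le_trans x0).
have [nd1 U1] := cover_itv dg ih g0 cov.
have [||||nd2 U2] := @cover_itv (q \o g) (q \o h).
- by move=> m n mn; apply: qle; [exact: ltW|exact: dg].
- by move=> m n mn; apply: qle; [exact: ler0n|exact: ih].
- by move=> n; rewrite divr_gt0// exprn_gt0.
- move=> x x0; have [|n /andP[gx xh]] := cov (Num.sqrt (x * 2)).
    by rewrite sqrtr_gt0 mulr_gt0.
  have qx : q (Num.sqrt (x * 2)) = x by rewrite /q sqr_sqrtr ?mulfK// mulr_ge0// ltW.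
  by exists n; rewrite -qx /= !qle// ?sqrtr_ge0// ltW.
have mf : measurable_fun [set: R] (fun u : R => u `^ (b - 1) * expR (- u)).
  by apply: measurable_funM; [exact: measurable_powR|exact: measurableT_comp].
have mg : measurable_fun [set: R]
    (fun t : R => 2 `^ (1 - b) * gaussian_power (2 * b - 1) t).
  by apply: measurable_funM => //; exact: measurable_gaussian_power.
rewrite -integral_itv_obnd_cbnd; last exact/measurable_EFinP/measurable_funTS.
rewrite -{1}U2 -U1.
have c2 := @ge0_nondecreasing_set_cvg_integral _ (measurableTypeR R) R _
  (fun u : R => (u `^ (b - 1) * expR (- u))%:E) mu nd2.
have c1 := @ge0_nondecreasing_set_cvg_integral _ (measurableTypeR R) R _
  (fun t : R => (2 `^ (1 - b) * gaussian_power (2 * b - 1) t)%:E) mu nd1.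
apply: (cvg_unique _ (c2 _ _ _) _) => //.
- by move=> n; apply/measurable_EFinP/measurable_funTS.
- by move=> n x _; rewrite lee_fin mulr_ge0 ?powR_ge0 ?expR_ge0.
rewrite (_ : (fun _ => _) = (fun n => \int[mu]_(t in `[g n, h n])
    (2 `^ (1 - b) * gaussian_power (2 * b - 1) t)%:E)%E); last first.
  by apply/funext => n; exact: gamma_substitution_itv.
apply: c1 => //.
- by move=> n; apply/measurable_EFinP/measurable_funTS.
- by move=> n x _; rewrite lee_fin mulr_ge0 ?powR_ge0 ?gaussian_power_ge0.
Qed.

End gaussian_moments.

(** * Gaussian moments and the functional equation of Gamma *)

Section gaussian_moment_recurrence.
Context {R : realType}.
Local Notation mu := (@lebesgue_measure R).
Implicit Types (b p t : R).

(** Half of the Gaussian absorbs the power. The bound yields integrability and the vanishing of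
    boundary terms at infinity. *)
Lemma gaussian_power_bound p : 0 <= p ->
  exists2 C : R, 0 <= C &
    forall t, 0 <= t -> gaussian_power p t <= C * expR (- (t ^+ 2 / 4)).
Proof.
(* For [t <= 1] the power is at most 1; for [t > 1] it is at most [t^(2k)], which the [k]-th term of
   the series of [exp(t^2/4)] controls. The constant adds the two bounds. *)
move=> p0; pose k := (Num.truncn p).+1.
have pk : p <= (2 * k)%:R.
  by rewrite (le_trans (ltW (truncnS_gt p)))// ler_nat leq_pmull.
exists (1 + 4 ^+ k * k`!%:R); first by rewrite addr_ge0// mulr_ge0// exprn_ge0.
move=> t t0; have q0 : 0 <= t ^+ 2 / 4 by rewrite divr_ge0// sqr_ge0.
have -> : gaussian_power p t = t `^ p * expR (- (t ^+ 2 / 4)) * expR (- (t ^+ 2 / 4)).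
  by rewrite /gaussian_power -mulrA -expRD; congr (_ * expR _); field.
rewrite ler_wpM2r ?expR_ge0// expRN ler_pdivrMr ?expR_gt0//.
have e1 : 1 <= expR (t ^+ 2 / 4) by rewrite -[leLHS]expR0 ler_expR.
have e2 : t ^+ (2 * k) <= 4 ^+ k * k`!%:R * expR (t ^+ 2 / 4).
  have /(_ k.-1) := expR_ge1Dxn _ q0; rewrite prednK// => h.
  have {h}: (t ^+ 2 / 4) ^+ k / k`!%:R <= expR (t ^+ 2 / 4).
    by apply: le_trans h; rewrite lerDr.
  rewrite ler_pdivrMr ?ltr0n ?fact_gt0// expr_div_n ler_pdivrMr ?exprn_gt0//.
  rewrite exprM => /le_trans; apply; rewrite le_eqVlt; apply/orP; left; apply/eqP; ring.
have [t1|t1] := leP t 1.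
  rewrite (@le_trans _ _ 1)//; last first.
    by rewrite mulrDl mul1r ler_wpDr// mulr_ge0 ?expR_ge0// mulr_ge0// exprn_ge0.
  by apply: le_trans (ge0_ler_powR p0 _ _ t1) _; rewrite ?nnegrE ?powR1.
apply: (@le_trans _ _ (t ^+ (2 * k))).
  by rewrite -powR_mulrn//; apply: ler_powR => //; exact: ltW.
by apply: le_trans e2 _; rewrite ler_wpM2r ?expR_ge0// lerDr.
Qed.

(** Up to its peak value this is the normal density of variance 2. *)
Lemma integrable_gaussian_quarter :
  mu.-integrable setT (fun t => (expR (- (t ^+ 2 / 4)))%:E).
Proof.
have s0 : Num.sqrt (2 : R) != 0 by rewrite gt_eqF// sqrtr_gt0.
have peak : 0 < normal_peak (Num.sqrt 2 : R) by exact: normal_peak_gt0.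
have -> : (fun t : R => (expR (- (t ^+ 2 / 4)))%:E) = (fun t : R =>
    ((normal_peak (Num.sqrt 2))^-1%:E * (normal_pdf 0 (Num.sqrt 2) t)%:E)%E).
  apply/funext => t; rewrite -EFinM /normal_pdf (negPf s0) mulKf ?gt_eqF//.
  rewrite /normal_fun subr0 sqr_sqrtr// -mulr_natr mulNr.
  by congr (expR _)%:E; congr (- (_ / _)); ring.
by apply: integrableZl => //; exact: integrable_normal_pdf.
Qed.

Lemma integrable_gaussian_power p : 0 <= p ->
  mu.-integrable `[0, +oo[ (EFin \o gaussian_power p).
Proof.
move=> p0; have [C C0 hC] := gaussian_power_bound p0.
apply: (@le_integrable _ _ _ mu _ _ _
   (fun t => (C%:E * (expR (- (t ^+ 2 / 4)))%:E)%E)) => //.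
- by apply/measurable_EFinP/measurable_funTS; exact: measurable_gaussian_power.
- move=> t; rewrite /= in_itv/= andbT => t0.
  rewrite lee_fin !ger0_norm ?gaussian_power_ge0 ?mulr_ge0 ?expR_ge0//.
  exact: hC.
- apply: integrableZl => //; apply: integrableS integrable_gaussian_quarter => //.
Qed.

Definition gaussian_moment p : R := \int[mu]_(t in `[0, +oo[) gaussian_power p t.

Lemma gaussian_momentE p : 0 <= p ->
  (\int[mu]_(t in `[0%R, +oo[) (gaussian_power p t)%:E)%E = (gaussian_moment p)%:E.
Proof.
move=> p0; rewrite /gaussian_moment /Rintegral fineK//.
by apply: integrable_fin_num => //; exact: integrable_gaussian_power.
Qed.

Lemma gaussian_moment_cvg p : 0 <= p ->
  \int[mu]_(t in `[0, n.+1%:R]) gaussian_power p t @[n --> \oo] --> gaussian_moment p.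
Proof.
move=> p0; apply: fine_cvg; rewrite -gaussian_momentE//.
have := @ge0_cvgn_integral R mu _ (gaussian_power_ge0 p) (measurable_gaussian_power p).
by rewrite -cvg_shiftS.
Qed.

Lemma gaussian_power_continuous p : 0 <= p ->
  {within `[0, +oo[, continuous (gaussian_power p)}.
Proof.
move=> p0.
have cexp t : {for t, continuous (fun t : R => expR (- (t ^+ 2 / 2)))}.
  apply: continuous_comp; last exact: continuous_expR.
  apply: continuousN; apply/differentiable_continuous/derivable1_diffP.
  exact: derivable_half_sqr.
apply/continuous_within_itvcyP; split.
  move=> t; rewrite in_itv/= andbT => t0; apply: cvgM; last exact: cexp.
  have : {for t, continuous (fun s : R => s `^ p)}.
    apply/differentiable_continuous/derivable1_diffP/derivable_powR.
    by rewrite in_itv/= t0.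
  exact.
apply: cvgM; last by apply: cvg_at_right_filter; exact: cexp.
(* At 0 the power is 1 when [p = 0] and 0 otherwise, so continuity at the endpoint has two cases. *)
have [->|pn0] := eqVneq p 0.
  by under eq_fun do rewrite powRr0; rewrite powRr0; exact: cvg_cst.
by rewrite powR0//; apply: powR_cvg0; rewrite lt0r pn0.
Qed.

(** Integrate the derivative [f] of [t^(p+1) e^(-t^2/2)] over [[0, n + 1]]; the boundary term
    vanishes at 0 and tends to 0 as [n] grows. *)
Lemma gaussian_moment_recurrence p : 0 <= p ->
  gaussian_moment (p + 2) = (p + 1) * gaussian_moment p.
Proof.
move=> p0.
have p1 : 0 <= p + 1 by rewrite addr_ge0.
have p2 : 0 <= p + 2 by rewrite addr_ge0.
pose f t := (p + 1) * gaussian_power p t - gaussian_power (p + 2) t.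
have wsub (n : nat) (q : R) : 0 <= q -> {within `[0, n.+1%:R], continuous (gaussian_power q)}.
  move=> q0; apply: (continuous_subspaceW _ (gaussian_power_continuous q0)).
  by move=> x/=; rewrite !in_itv/= andbT => /andP[].
have ig (n : nat) (q : R) : 0 <= q -> mu.-integrable `[0, n.+1%:R] (EFin \o gaussian_power q).
  move=> q0; apply: integrableS (integrable_gaussian_power q0) => //.
  by move=> x/=; rewrite !in_itv/= andbT => /andP[].
have F0 : gaussian_power (p + 1) 0 = 0.
  by rewrite /gaussian_power powR0 ?mul0r// gt_eqF// ltr_wpDl.
have step (n : nat) : (p + 1) * (\int[mu]_(t in `[0, n.+1%:R]) gaussian_power p t) -
    \int[mu]_(t in `[0, n.+1%:R]) gaussian_power (p + 2) t =
    gaussian_power (p + 1) n.+1%:R.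
  have : (\int[mu]_(t in `[0%R, n.+1%:R]) (f t)%:E =
     (gaussian_power (p + 1) n.+1%:R)%:E - (gaussian_power (p + 1) 0)%:E)%E.
    apply: continuous_FTC2 => //.
    - move=> x; apply: cvgB; last exact: wsub.
      by apply: cvgM; [exact: cvg_cst|exact: wsub].
    - have /continuous_within_itvP[] := wsub n _ p1 => //.
      move=> _ c0 c1; split => // x; rewrite in_itv/= => /andP[x0 _].
      apply: derivableM; first by apply: derivable_powR; rewrite in_itv/= x0.
      apply: diff_derivable; apply: differentiable_comp; last first.
        exact/derivable1_diffP/derivable_expR.
      by apply: differentiableN; apply/derivable1_diffP/derivable_half_sqr.
    - move=> x; rewrite in_itv/= => /andP[x0 _].
      have dN : derivable (fun t : R => - (t ^+ 2 / 2)) x 1.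
        by apply: derivableN; exact: derivable_half_sqr.
      have dE : derivable (fun t : R => expR (- (t ^+ 2 / 2))) x 1.
        apply: diff_derivable; apply: differentiable_comp; first exact/derivable1_diffP.
        exact/derivable1_diffP/derivable_expR.
      have dP : derivable (fun t : R => t `^ (p + 1)) x 1.
        by apply: derivable_powR; rewrite in_itv/= x0.
      have dEE : derive1 (fun t : R => expR (- (t ^+ 2 / 2))) x =
          expR (- (x ^+ 2 / 2)) * (- x).
        have /= -> := derive1_comp dN (@derivable_expR R _).
        rewrite !derive1E (congr1 (@^~ (- (x ^+ 2 / 2))) (@derive_expR R)).
        rewrite deriveN; last exact: derivable_half_sqr.
        by rewrite -derive1E derive_half_sqr.
      rewrite derive1E (deriveM dP dE) -!derive1E powR_derive1 ?in_itv/= ?x0//.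
      rewrite dEE /f /gaussian_power addrK /GRing.scale/=.
      have -> : x `^ (p + 2) = x `^ (p + 1) * x.
        rewrite -[X in _ * X](powRr1 (ltW x0)) -powRD ?(gt_eqF x0) ?implybT//.
        by congr (_ `^ _); ring.
      by ring.
  rewrite F0 sube0 => h.
  rewrite -RintegralZl//; last exact: ig.
  rewrite -RintegralB//.
  - by rewrite /Rintegral h.
  - exact: (integrableZl _ (p + 1) (ig n p p0)).
  - exact: ig.
have [C C0 hC] := gaussian_power_bound p2.
(* The bound for the exponent [p + 2], divided by [t = n + 1], gives decay of order [1/(n + 1)]. *)
have l0 : gaussian_power (p + 1) n.+1%:R @[n --> \oo] --> (0 : R).
  have h0 : C * harmonic n @[n --> \oo] --> (0 : R).
    by rewrite -(mulr0 C); apply: cvgM; [exact: cvg_cst|exact: cvg_harmonic].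
  apply: squeeze_cvgr (@cvg_cst _ 0 _ _ _) h0; apply: nearW => n.
  rewrite gaussian_power_ge0/= /harmonic ler_pdivlMr//.
  have := hC n.+1%:R (ler0n _ _); rewrite /gaussian_power.
  rewrite (_ : p + 2 = p + 1 + 1); last by ring.
  rewrite [n.+1%:R `^ (p + 1 + 1)]powRD ?powRr1//; last by rewrite pnatr_eq0 implybT.
  rewrite mulrAC => /le_trans; apply.
  by rewrite ler_piMr// -[leRHS]expR0 ler_expR oppr_le0.
apply/eqP; rewrite eq_sym -subr_eq0; apply/eqP.
have : gaussian_power (p + 1) n.+1%:R @[n --> \oo] -->
    (p + 1) * gaussian_moment p - gaussian_moment (p + 2).
  rewrite -(funext step); apply: cvgB; last exact: gaussian_moment_cvg.
  by apply: cvgM; [exact: cvg_cst|exact: gaussian_moment_cvg].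
by move=> /cvg_unique; apply.
Qed.

Lemma GammaE b : 2^-1 <= b ->
  Gamma b = 2 `^ (1 - b) * gaussian_moment (2 * b - 1).
Proof.
move=> hb; have p0 : 0 <= 2 * b - 1 by lra.
rewrite /Gamma {1}/Rintegral gamma_substitution.
under eq_integral do rewrite EFinM.
rewrite integralZl//; last exact: integrable_gaussian_power.
by rewrite gaussian_momentE.
Qed.

Lemma gaussian_moment_gt0 p : 0 <= p -> 0 < gaussian_moment p.
Proof.
move=> p0; rewrite lt0r Rintegral_ge0 ?andbT; last first.
  by move=> t _; exact: gaussian_power_ge0.
apply/eqP => m0.
have /= := @ae_eq_integral_abs _ _ R mu `[0, +oo[%classic _ (EFin \o gaussian_power p).
rewrite (_ : (\int[mu]_(x in _) _)%E = (gaussian_moment p)%:E); last first.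
  rewrite -gaussian_momentE//; apply: eq_integral => x _.
  by rewrite /= ger0_norm// gaussian_power_ge0.
rewrite m0; move=> /(_ _ _)[||/(_ erefl) h _] => //.
  by apply/measurable_EFinP/measurable_funTS; exact: measurable_gaussian_power.
case: h => N [mN N0 subN].
(* A zero moment would make the integrand vanish almost everywhere, yet it is positive on
   [[1, 2]]. *)
have : (mu `[1%R, 2%R] <= mu N)%E.
  apply: le_measure; rewrite ?inE//.
  move=> x/=; rewrite in_itv/= => /andP[x1 _]; apply: subN => /=.
  rewrite in_itv/= andbT (le_trans ler01 x1) => /(_ isT)[] /eqP.
  by rewrite gt_eqF// mulr_gt0 ?expR_gt0// powR_gt0// (lt_le_trans ltr01).
rewrite N0 lebesgue_measure_itv/= lte_fin ltr1n -EFinD lee_fin.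
by rewrite leNgt => /negP; apply; lra.
Qed.

Lemma Gamma_gt0 b : 2^-1 <= b -> 0 < Gamma b.
Proof.
by move=> hb; rewrite GammaE// mulr_gt0 ?powR_gt0// gaussian_moment_gt0//; lra.
Qed.

Lemma GammaS b : 2^-1 <= b -> Gamma (b + 1) = b * Gamma b.
Proof.
move=> hb; rewrite !GammaE//; last by lra.
rewrite (_ : 2 * (b + 1) - 1 = 2 * b - 1 + 2); last by ring.
rewrite gaussian_moment_recurrence; last by lra.
have -> : 2 `^ (1 - b) = 2 `^ (1 - (b + 1)) * 2 :> R.
  rewrite -[X in _ * X]powRr1// -powRD ?pnatr_eq0 ?implybT//.
  by congr (_ `^ _); ring.
by ring.
Qed.

Lemma Gamma_poch b n : 2^-1 <= b -> Gamma (b + n%:R) = Gamma b * poch b n.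
Proof.
move=> hb; elim: n => [|n IH]; first by rewrite addr0 poch0 mulr1.
rewrite -natr1 addrA GammaS ?IH ?pochS; first by ring.
by rewrite (le_trans hb)// lerDl.
Qed.

End gaussian_moment_recurrence.

(** * Integrable functions on the real line with a known integral *)

Section integrals_on_the_line.
Context {R : realType}.
Local Notation mu := (@lebesgue_measure R).
Implicit Types (f g : R -> R) (a b : R).

(** Integrability travels with the value, so linear combinations need no separate integrability
    proofs. *)
Definition has_integral f a : Prop :=
  mu.-integrable setT (EFin \o f) /\ (\int[mu]_t (f t)%:E = a%:E)%E.

Lemma has_integral_Rintegral f a : has_integral f a -> \int[mu]_t f t = a.
Proof. by case=> _ h; rewrite /Rintegral h. Qed.

Lemma has_integral_measurable f a : has_integral f a -> measurable_fun setT f.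
Proof. by case=> /measurable_int/measurable_EFinP. Qed.

Lemma integrable_has_integral f :
  mu.-integrable setT (EFin \o f) -> has_integral f (\int[mu]_t f t).
Proof. by move=> fi; split=> //; rewrite /Rintegral fineK//; exact: integrable_fin_num. Qed.

Lemma eq_has_integral f g a : f =1 g -> has_integral f a -> has_integral g a.
Proof. by move=> /funext ->. Qed.

Lemma ge0_has_integral f a : measurable_fun setT f -> (forall t, 0 <= f t) ->
  (\int[mu]_t (f t)%:E = a%:E)%E -> has_integral f a.
Proof.
move=> mf f0 fa; split=> //; apply/integrableP; split; first exact/measurable_EFinP.
by under eq_integral do rewrite /= ger0_norm//; rewrite fa ltry.
Qed.

Lemma has_integralZ f a c : has_integral f a -> has_integral (fun t => c * f t) (c * a).
Proof.
move=> [fi fa]; split; first exact: (integrableZl measurableT c fi).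
by under eq_integral do rewrite EFinM; rewrite integralZl// fa.
Qed.

Lemma has_integralD f g a b : has_integral f a -> has_integral g b ->
  has_integral (fun t => f t + g t) (a + b).
Proof.
move=> [fi fa] [gi gb]; split; first exact: (integrableD measurableT fi gi).
by under eq_integral do rewrite EFinD; rewrite integralD// fa gb.
Qed.

Lemma has_integral0 : has_integral (fun=> 0) 0.
Proof. by split; [exact: integrable0|exact: integral0]. Qed.

Lemma has_integral_sum (I : Type) (s : seq I) (F : I -> R -> R) (A : I -> R) :
  (forall i, has_integral (F i) (A i)) ->
  has_integral (fun t => \sum_(i <- s) F i t) (\sum_(i <- s) A i).
Proof.
move=> FA; elim: s => [|i s IH].
  rewrite big_nil; apply: eq_has_integral has_integral0.
  by move=> t; rewrite big_nil.
rewrite big_cons; apply: eq_has_integral (has_integralD (FA i) IH).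
by move=> t; rewrite big_cons.
Qed.

Lemma le_has_integral f g a : measurable_fun setT f ->
  (forall t, `|f t| <= g t) -> has_integral g a -> mu.-integrable setT (EFin \o f).
Proof.
move=> mf fg [gi _]; apply: (le_integrable _ _ _ gi) => //; first exact/measurable_EFinP.
by move=> t _ /=; rewrite lee_fin (le_trans (fg t))// ler_norm.
Qed.

Lemma ge0_integral_opp f : measurable_fun setT f -> (forall t, 0 <= f t) ->
  (\int[mu]_t (f (- t))%:E = \int[mu]_t (f t)%:E)%E.
Proof.
move=> mf f0.
rewrite -[LHS](@ge0_integral_pushforward _ _ (measurableTypeR R) (measurableTypeR R)
  R -%R _ mu setT (EFin \o f))//.
- by apply: eq_measure_integral => A mA _; exact: lebesgue_measureN.
- exact/measurable_EFinP.
- by move=> t _; rewrite lee_fin.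
Qed.

Lemma Rintegral_odd f : measurable_fun setT f -> (forall t, f (- t) = - f t) ->
  \int[mu]_t f t = 0.
Proof.
move=> mf fodd.
have pE : (\int[mu]_t ((EFin \o f)^\+ t) = \int[mu]_t ((EFin \o f)^\- t))%E.
  rewrite (_ : (EFin \o f)^\+%E = fun t => (Num.max (f t) 0)%:E); last first.
    by apply/funext => t; rewrite funeposE /= EFin_max.
  rewrite (_ : (EFin \o f)^\-%E = fun t => (Num.max (f (- t)) 0)%:E); last first.
    by apply/funext => t; rewrite funenegE /= fodd EFin_max EFinN.
  rewrite (@ge0_integral_opp (fun t => Num.max (f t) 0))//.
  - by apply: measurable_maxr.
  - by move=> t; rewrite le_max lexx orbT.
(* If both parts have infinite integral, their difference is infinite and [fine] sends it to 0. *)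
rewrite /Rintegral integralE pE.
by case: (integral _ _ _) => //= r; rewrite subrr.
Qed.


Lemma ge0_integral_even f : measurable_fun setT f -> (forall t, 0 <= f t) ->
  (forall t, f (- t) = f t) ->
  (\int[mu]_t (f t)%:E = 2%:E * \int[mu]_(t in `[0%R, +oo[) (f t)%:E)%E.
Proof.
move=> mf f0 feven.
have -> : [set: R] = `]-oo, 0%R] `|` `]0%R, +oo[.
  by apply/seteqP; split=> // x _ /=; rewrite !in_itv/= andbT; case: leP; [left|right].
rewrite ge0_integral_setU//=.
- rewrite integral_itv_obnd_cbnd; last exact/measurable_EFinP/measurable_funTS.
  rewrite mule_natl mule2n; congr (_ + _)%E.
  rewrite [RHS](@ge0_integration_by_substitution0 _ (EFin \o f)).
  - by apply: eq_integral => t _; rewrite /= feven.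
  - exact/measurable_EFinP.
  - by move=> r; rewrite lee_fin.
- exact/measurable_EFinP/measurable_funTS.
- by move=> t _; rewrite lee_fin.
- rewrite disj_set2E; apply/eqP; rewrite -subset0 => x []/= /[!in_itv]/=.
  by rewrite andbT leNgt => /negP.
Qed.

End integrals_on_the_line.

(** * Weber's second exponential integral *)

Section weber.
Context {R : realType}.
Local Notation mu := (@lebesgue_measure R).
Implicit Types (b u v t : R).

Definition radial_weight b t : R := gaussian_power (2 * b - 1) `|t|.

Lemma radial_weight_ge0 b t : 0 <= radial_weight b t.
Proof. exact: gaussian_power_ge0. Qed.

Lemma measurable_radial_weight b : measurable_fun setT (radial_weight b).
Proof.
by apply: measurableT_comp; [exact: measurable_gaussian_power|exact: normr_measurable].
Qed.

(** Trading [t^2] for a shift of [b] serves both the moments and the odd parts of the kernels. *)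
Lemma radial_weightS b t : 2^-1 <= b ->
  radial_weight (b + 1) t = radial_weight b t * t ^+ 2.
Proof.
move=> hb; rewrite /radial_weight /gaussian_power.
rewrite -[X in _ = _ * X](_ : `|t| ^+ 2 = _); last by rewrite real_normK ?num_real.
rewrite [RHS]mulrAC; congr (_ * _); rewrite -powR_mulrn// -powRD.
  by congr (_ `^ _); ring.
by apply/implyP => /eqP h; exfalso; lra.
Qed.

Lemma radial_moment b k : 2^-1 <= b ->
  has_integral (fun t => radial_weight b t * (t ^+ 2) ^+ k)
    (2 `^ b * Gamma b * (2 ^+ k * poch b k)).
Proof.
elim: k b => [|k IH] b hb; last first.
  have hb1 : 2^-1 <= b + 1 by lra.
  rewrite pochSl.
  have -> : 2 `^ b * Gamma b * (2 ^+ k.+1 * (b * poch (b + 1) k)) =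
      2 `^ (b + 1) * Gamma (b + 1) * (2 ^+ k * poch (b + 1) k).
    rewrite GammaS// powRD ?pnatr_eq0 ?implybT// powRr1// exprS; ring.
  by apply: eq_has_integral (IH _ hb1) => t; rewrite radial_weightS// [_ ^+ k.+1]exprS mulrA.
rewrite poch0 !mulr1.
apply: ge0_has_integral.
- by apply: measurable_funM => //; exact: measurable_radial_weight.
- by move=> t; rewrite mulr1 radial_weight_ge0.
rewrite ge0_integral_even.
(* Evenness contributes a factor 2, which equals [2^b * 2^(1-b)] and so cancels the constant in
   [GammaE]. *)
- rewrite (_ : (\int[mu]_(t in _) _)%E = (gaussian_moment (2 * b - 1))%:E).
    rewrite -EFinM GammaE// mulrA -powRD ?pnatr_eq0 ?implybT//.
    rewrite (_ : b + (1 - b) = 1); last by ring.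
    by rewrite powRr1.
  rewrite -gaussian_momentE; last by lra.
  apply: eq_integral => t; rewrite inE/= in_itv/= andbT => t0.
  by rewrite mulr1 /radial_weight ger0_norm.
- by apply: measurable_funM => //; exact: measurable_radial_weight.
- by move=> t; rewrite mulr1 radial_weight_ge0.
- by move=> t; rewrite /radial_weight normrN.
Qed.

Let cvg_bessel b z : 2^-1 <= b -> series (bessel_coeff b z) @ \oo --> bessel b z.
Proof. exact: is_cvg_bessel. Qed.

Lemma measurable_bessel b u : 2^-1 <= b ->
  measurable_fun setT (fun t => bessel b (u * t ^+ 2)).
Proof.
move=> hb; apply: (@measurable_fun_cvg _ _ _ _
  (fun n t => series (bessel_coeff b (u * t ^+ 2)) n)) => //.
- move=> n; rewrite /series/=; apply: measurable_sum => i.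
  apply: measurable_funM => //; apply: measurable_funX.
  by apply: measurable_funM => //; exact: measurable_funX.
- by move=> t _; exact: cvg_bessel.
Qed.

Definition weber_integrand b u v t : R :=
  radial_weight b t * (bessel b (u * t ^+ 2) * bessel b (v * t ^+ 2)).

Let partial_integrand b u v n t : R := radial_weight b t *
  (series (bessel_coeff b (u * t ^+ 2)) n * series (bessel_coeff b (v * t ^+ 2)) n).

(** The factor [2^(i+j)] of the moment of order [i + j] is what doubles [u] and [v]. *)
Let partial_integral b u v n : 2^-1 <= b ->
  has_integral (partial_integrand b u v n)
    (2 `^ b * Gamma b * weber_partial b (2 * u) (2 * v) n).
Proof.
move=> hb; pose c i j := u ^+ i * v ^+ j / (i`!%:R * j`!%:R * poch b i * poch b j).
have := @has_integral_sum _ _ (index_iota 0 n)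
  (fun i t => \sum_(0 <= j < n) c i j * (radial_weight b t * (t ^+ 2) ^+ (i + j)))
  _ (fun i => has_integral_sum _ (fun j => has_integralZ (c i j) (radial_moment (i + j) hb))).
rewrite (_ : \sum_(_ <- _) _ = 2 `^ b * Gamma b * weber_partial b (2 * u) (2 * v) n).
  apply: eq_has_integral => t; rewrite /partial_integrand !seriesEnat/=.
  rewrite big_distrlr/= mulr_sumr; apply: eq_bigr => i _; rewrite mulr_sumr.
  apply: eq_bigr => j _; rewrite /c /bessel_coeff; move: (t ^+ 2) => w.
  by rewrite !exprMn exprD !invfM; ring.
rewrite /weber_partial mulr_sumr; apply: eq_bigr => i _; rewrite mulr_sumr.
apply: eq_bigr => j _; rewrite /c !exprMn exprD !invfM.
by ring.
Qed.

Let cvg_partial_integrand b u v t : 2^-1 <= b ->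
  partial_integrand b u v n t @[n --> \oo] --> weber_integrand b u v t.
Proof.
move=> hb; apply: cvgM; first exact: cvg_cst.
by apply: cvgM; exact: cvg_bessel.
Qed.

Let weberval b u v : R := 2 `^ b * Gamma b *
  (bessel b (2 * u * (2 * v)) * (expR (2 * u) * expR (2 * v))).

Let cvg_partial_integral b u v : 2^-1 <= b ->
  (\int[mu]_t (partial_integrand b u v n t)%:E)%E @[n --> \oo] --> (weberval b u v)%:E.
Proof.
move=> hb.
rewrite (_ : (fun n => _) = EFin \o (fun n =>
    2 `^ b * Gamma b * weber_partial b (2 * u) (2 * v) n)); last first.
  by apply/funext => n; have [_] := partial_integral u v n hb.
apply: cvg_EFin; first exact: nearW.
by apply: cvgM; [exact: cvg_cst|exact: cvg_weber_partial].
Qed.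

Let measurable_weber_integrand b u v : 2^-1 <= b ->
  measurable_fun setT (weber_integrand b u v).
Proof.
move=> hb; apply: measurable_funM; first exact: measurable_radial_weight.
by apply: measurable_funM; exact: measurable_bessel.
Qed.

Let weber_integral_ge0 b u v : 2^-1 <= b -> 0 <= u -> 0 <= v ->
  has_integral (weber_integrand b u v) (weberval b u v).
Proof.
move=> hb u0 v0; have b0 : 0 < b by lra.
have z0 (z t : R) : 0 <= z -> 0 <= z * t ^+ 2 by move=> ?; rewrite mulr_ge0// sqr_ge0.
have s0 (z t : R) n : 0 <= z -> 0 <= series (bessel_coeff b (z * t ^+ 2)) n.
  move=> zz; have h := z0 z t zz; rewrite seriesEnat/=.
  by apply: sumr_ge0 => i _; exact: bessel_coeff_ge0.
apply: ge0_has_integral.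
- exact: measurable_weber_integrand.
- by move=> t; rewrite mulr_ge0 ?radial_weight_ge0// mulr_ge0// bessel_ge0// z0.
have cv := @cvg_monotone_convergence _ _ _ mu setT measurableT
  (fun n t => (partial_integrand b u v n t)%:E).
have {cv} /= := cv _ _ _.
rewrite (_ : (\int[mu]_(x in _) _)%E =
  (\int[mu]_t (weber_integrand b u v t)%:E)%E); last first.
  apply: eq_integral => t _; apply/cvg_lim => //.
  by apply: cvg_EFin; [exact: nearW|exact: cvg_partial_integrand].
move=> cv; apply: (cvg_unique _ (cv _ _ _)) => //.
- move=> n; apply/measurable_EFinP.
  exact: has_integral_measurable (partial_integral u v n hb).
- by move=> n t _; rewrite lee_fin mulr_ge0 ?radial_weight_ge0// mulr_ge0// s0.
- move=> t _ m n mn; rewrite lee_fin ler_wpM2l ?radial_weight_ge0//.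
  by rewrite ler_pM ?s0//; apply: nondecreasing_bessel => //; exact: z0.
- exact: cvg_partial_integral.
Qed.

Lemma weber_integral b u v : 2^-1 <= b ->
  has_integral (weber_integrand b u v)
    (2 `^ b * Gamma b * (bessel b (4 * u * v) * expR (2 * u + 2 * v))).
Proof.
move=> hb.
have -> : 2 `^ b * Gamma b * (bessel b (4 * u * v) * expR (2 * u + 2 * v)) =
    weberval b u v.
  by rewrite /weberval expRD; congr (_ * (bessel _ _ * _)); ring.
have [gi _] := weber_integral_ge0 hb (normr_ge0 u) (normr_ge0 v).
have [||||fi _ cv] := @dominated_convergence _ _ _ mu setT measurableT
  (fun n t => (partial_integrand b u v n t)%:E)
  (fun t => (weber_integrand b u v t)%:E)
  (EFin \o weber_integrand b `|u| `|v|) _ _ _ gi.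
- move=> n; apply/measurable_EFinP.
  exact: has_integral_measurable (partial_integral u v n hb).
- by apply/measurable_EFinP; exact: measurable_weber_integrand.
- apply: aeW => t _; apply: cvg_EFin; first exact: nearW.
  exact: cvg_partial_integrand.
- apply: aeW => t n _; rewrite /= lee_fin /partial_integrand normrM.
  rewrite (ger0_norm (radial_weight_ge0 _ _)) normrM.
  rewrite ler_wpM2l ?radial_weight_ge0// ler_pM//.
    rewrite (le_trans (bessel_partial_le _ _ hb))// normrM normrX real_normK ?num_real//.
    by rewrite bessel_partial_le_lim// mulr_ge0// sqr_ge0.
  rewrite (le_trans (bessel_partial_le _ _ hb))// normrM normrX real_normK ?num_real//.
  by rewrite bessel_partial_le_lim// mulr_ge0// sqr_ge0.
- split=> //; apply: (cvg_unique _ cv) => //; exact: cvg_partial_integral.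
Qed.

End weber.

(** * Quaternion algebra on a slice, and series in one quaternion *)

Section quaternions.
Context {R : realType}.
Implicit Types (a b c d y : R) (p q J : quat R).

Lemma qcZ n a q : qc n (a *: q) = a * qc n q.
Proof. by rewrite /qc mxE. Qed.

Lemma qcN n q : qc n (- q) = - qc n q.
Proof. by rewrite /qc mxE. Qed.

Lemma qc1 : (qc 0 (1 : quat R) = 1) * (qc 1 (1 : quat R) = 0) *
  (qc 2 (1 : quat R) = 0) * (qc 3 (1 : quat R) = 0).
Proof. exact: qc_mkquat. Qed.

Lemma qcM p q :
  (qc 0 (p * q) = qc 0 p * qc 0 q - qc 1 p * qc 1 q - qc 2 p * qc 2 q - qc 3 p * qc 3 q) *
  (qc 1 (p * q) = qc 0 p * qc 1 q + qc 1 p * qc 0 q + qc 2 p * qc 3 q - qc 3 p * qc 2 q) *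
  (qc 2 (p * q) = qc 0 p * qc 2 q - qc 1 p * qc 3 q + qc 2 p * qc 0 q + qc 3 p * qc 1 q) *
  (qc 3 (p * q) = qc 0 p * qc 3 q + qc 1 p * qc 2 q - qc 2 p * qc 1 q + qc 3 p * qc 0 q).
Proof. exact: qc_mkquat. Qed.

Lemma qscalerAl a p q : (a *: p) * q = a *: (p * q).
Proof. by apply: quatP; rewrite qcZ !qcM !qcZ; ring. Qed.

Lemma qscalerAr a p q : p * (a *: q) = a *: (p * q).
Proof. by apply: quatP; rewrite qcZ !qcM !qcZ; ring. Qed.

Lemma imaginary_unit_qc J : imaginary_unit J ->
  qc 0 J = 0 /\ qc 1 J ^+ 2 + qc 2 J ^+ 2 + qc 3 J ^+ 2 = 1.
Proof.
rewrite /imaginary_unit/= expr2 => JJ.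
have := congr1 (qc 0) JJ; have := congr1 (qc 1) JJ.
have := congr1 (qc 2) JJ; have := congr1 (qc 3) JJ.
rewrite !qcN !qc1 !qcM !oppr0 => e3 e2 e1 e0.
have c1 : qc 0 J * qc 1 J = 0 by lra.
have c2 : qc 0 J * qc 2 J = 0 by lra.
have c3 : qc 0 J * qc 3 J = 0 by lra.
(* A nonzero real part would kill the imaginary coordinates and leave a real number with square
   -1. *)
have J0 : qc 0 J = 0.
  apply: contrapT => /eqP J0.
  have z (r : R) : qc 0 J * r = 0 -> r = 0.
    by move=> /eqP; rewrite mulf_eq0 (negPf J0) => /eqP.
  move: e0; rewrite (z _ c1) (z _ c2) (z _ c3) !mulr0 !subr0 -expr2 => e0.
  by have := sqr_ge0 (qc 0 J); rewrite e0 lerNr oppr0 ler10.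
by split => //; move: e0; rewrite J0; lra.
Qed.

(** [q] is not restricted to imaginary units: [q = 1] and [q = 0] are used for real values. *)
Definition qslice q a b : quat R := a *: (1 : quat R) + b *: q.

Lemma qc_slice q a b n : qc n (qslice q a b) = a * qc n 1 + b * qc n q.
Proof. by rewrite /qslice qcD !qcZ. Qed.

Lemma qslice_mul J a b c d : imaginary_unit J ->
  qslice J a b * qslice J c d = qslice J (a * c - b * d) (a * d + b * c).
Proof.
move=> /imaginary_unit_qc[J0 J1].
apply: quatP; rewrite !qcM !qc_slice !qc1 J0; last 3 first; try ring.
rewrite (_ : b * d = b * d * (qc 1 J ^+ 2 + qc 2 J ^+ 2 + qc 3 J ^+ 2)).
  by ring.
by rewrite J1 mulr1.
Qed.

Lemma qnorm_slice J a b : imaginary_unit J ->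
  qnorm (qslice J a b) ^+ 2 = a ^+ 2 + b ^+ 2.
Proof.
move=> /imaginary_unit_qc[J0 J1]; rewrite /qnorm sqr_sqrtr ?addr_ge0 ?sqr_ge0//.
rewrite !qc_slice !qc1 J0.
rewrite (_ : b ^+ 2 = b ^+ 2 * (qc 1 J ^+ 2 + qc 2 J ^+ 2 + qc 3 J ^+ 2)).
  by ring.
by rewrite J1 mulr1.
Qed.

Lemma qconj_slice J a b : imaginary_unit J ->
  qconj (qslice J a b) = qslice J a (- b).
Proof.
move=> /imaginary_unit_qc[J0 _]; apply: quatP;
  by rewrite /qconj !qc_mkquat !qc_slice !qc1 ?J0; ring.
Qed.

Lemma qconj_real a : qconj (qreal a) = qreal a.
Proof. by rewrite /qreal; apply: quatP; rewrite /qconj !qc_mkquat !qcZ !qc1; ring. Qed.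

Lemma cvg_series_even_odd (V : normedModType R) (u : V ^nat) (a b : V) :
  series (fun k => u k.*2) @ \oo --> a -> series (fun k => u k.*2.+1) @ \oo --> b ->
  series u @ \oo --> a + b.
Proof.
move=> ua ub.
have -> : series u = (fun n => series (fun k => u k.*2) (uphalf n) +
    series (fun k => u k.*2.+1) n./2).
  apply/funext => n; elim: n => [|n IH].
    by rewrite !seriesEnat/= !big_geq ?addr0.
  have serS (w : V ^nat) k : series w k.+1 = series w k + w k.
    by rewrite !seriesEnat/= big_nat_recr.
  rewrite (serS u) IH [uphalf n.+1]/= [n.+1./2]/= serS uphalf_half.
  have [on|en] := boolP (odd n); rewrite ?add1n ?add0n.
    by rewrite !serS -!addrA -[in u n](odd_double_half n) on.
  by rewrite -[in u n](odd_double_half n) (negPf en) add0n addrAC.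
have uphalf_cvg : (fun n : nat => uphalf n) @ \oo --> \oo.
  move=> P [N _ NP]; exists N.*2 => // n /= Nn; apply: NP => /=.
  by rewrite -(doubleK N) uphalfE half_leq// (leq_trans Nn).
apply: cvgD.
  exact: (cvg_comp _ _ uphalf_cvg ua).
exact: (cvg_comp _ _ cvg_half ub).
Qed.

Lemma cvg_series_scale (V : normedModType R) (u : R ^nat) (a : R) (v : V) :
  series u @ \oo --> a -> series (fun k => u k *: v) @ \oo --> a *: v.
Proof.
move=> ua; rewrite (_ : series _ = fun n => series u n *: v).
  by apply: cvgZr_tmp.
by apply/funext => n; rewrite !seriesEnat/= scaler_suml.
Qed.

(** Assuming only that [q^2] is a real [e] treats the real axis ([e = 1]) and the imaginary axis of
    a slice ([e = -1]) together. *)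
Lemma expr_scaled_even q e y k : q ^+ 2 = qreal e ->
  (y *: q) ^+ k.*2 = qreal ((e * y ^+ 2) ^+ k).
Proof.
rewrite /qreal => qe; elim: k => [|k IH]; first by rewrite !expr0 scale1r.
rewrite doubleS -addn2 exprD IH qscalerAl mul1r.
rewrite [(y *: q) ^+ 2]expr2 qscalerAl qscalerAr -[q * q]expr2 qe !scalerA.
by congr (_ *: _); rewrite [RHS]exprSr; ring.
Qed.

Lemma qexp_real y : qexp (qreal y) = qreal (expR y).
Proof.
rewrite /qreal; apply/cvg_lim => //.
rewrite (_ : (fun n => _) = fun n => exp_coeff y n *: (1 : quat R)).
  by apply: cvg_series_scale; exact: is_cvg_series_exp_coeff.
apply/funext => n; rewrite (_ : (y *: (1 : quat R)) ^+ n = y ^+ n *: (1 : quat R)).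
  by rewrite scalerA mulrC.
elim: n => [|n IH]; first by rewrite !expr0 scale1r.
by rewrite exprS IH qscalerAl mul1r scalerA -exprS.
Qed.

End quaternions.

(** * The Dunkl and Segal-Bargmann kernels in terms of Bessel functions *)

Section dunkl_kernels.
Context {R : realType}.
Context (alpha : R) (halpha : - 2^-1 <= alpha).
Implicit Types (e x y s t : R) (q J : quat R).
Local Notation mu := (@lebesgue_measure R).
Local Notation b := (alpha + 1).

Let b_ge : 2^-1 <= b. Proof. by move: halpha; lra. Qed.

Let b_gt0 : 0 < b. Proof. by move: halpha; lra. Qed.

Lemma beta_coefE n :
  beta_coef alpha n = 2 ^+ n * (n./2)`!%:R * poch b (uphalf n).
Proof.
rewrite /beta_coef -addrA addrC Gamma_poch// -!mulrA.
by congr (_ * (_ * _)); rewrite mulrCA mulfV ?mulr1// gt_eqF// Gamma_gt0.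
Qed.

(** Even powers of [q] are real and odd ones are real multiples of [q]. The coefficients are
    [4^k k! (b)_k] for index [2k] and [2b 4^k k! (b+1)_k] for [2k + 1], by
    [(b)_(k+1) = b (b+1)_k]. *)
Lemma L_dunkl_slice q e y : q ^+ 2 = qreal e ->
  L_dunkl alpha (y *: q) =
  qslice q (bessel b (e * y ^+ 2 / 4))
           (y / (2 * b) * bessel (b + 1) (e * y ^+ 2 / 4)).
Proof.
move=> qe; have b1 : 2^-1 <= b + 1 by move: b_ge; lra.
have nz c k : 0 < c -> poch c k != 0 by move=> c0; rewrite gt_eqF// poch_gt0.
have fz k : (k`!%:R : R) != 0 by rewrite pnatr_eq0 -lt0n fact_gt0.
have bz : b != 0 by rewrite gt_eqF.
apply/cvg_lim => //; apply: cvg_series_even_odd.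
  rewrite (_ : (fun k => _) = fun k =>
      bessel_coeff b (e * y ^+ 2 / 4) k *: (1 : quat R)).
    by apply: cvg_series_scale; exact: is_cvg_bessel.
  apply/funext => k; rewrite (expr_scaled_even _ _ qe) /qreal scalerA.
  congr (_ *: _); rewrite beta_coefE doubleK uphalf_double /bessel_coeff.
  have -> : (2 : R) ^+ k.*2 = 4 ^+ k.
    by rewrite -mul2n exprM; congr (_ ^+ _); ring.
  rewrite expr_div_n; field; rewrite fz nz//= expf_neq0//.
rewrite mulrC -scalerA.
rewrite (_ : (fun k => _) = fun k =>
    bessel_coeff (b + 1) (e * y ^+ 2 / 4) k *: (y / (2 * b) *: q)).
  by apply: cvg_series_scale; exact: is_cvg_bessel.
apply/funext => k; rewrite exprSr (expr_scaled_even _ _ qe) /qreal.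
rewrite qscalerAl mul1r !scalerA; congr (_ *: _).
rewrite beta_coefE /= uphalf_double doubleK /bessel_coeff pochSl.
have -> : (2 : R) ^+ k.*2.+1 = 2 * 4 ^+ k.
  by rewrite exprS -mul2n exprM; congr (_ * _ ^+ _); ring.
rewrite expr_div_n; field.
by rewrite bz fz nz ?expf_neq0//; move: b_ge; lra.
Qed.

(* For [q^2 = e] and [v = e x^2 / 2] these are, up to Gaussian and constant
   factors, the coefficients of [1] and [q] in [C_alpha(x q, t)]. *)
Definition even_bessel v t : R := bessel b (v * t ^+ 2).
Definition odd_bessel v t : R := t * bessel (b + 1) (v * t ^+ 2).

Definition kernel_const e x : R :=
  2 `^ (b / 2) * expR (- (e * x ^+ 2 / 2)).

Definition kernel_even e x t : R :=
  kernel_const e x * expR (- (t ^+ 2 / 2)) * even_bessel (e * x ^+ 2 / 2) t.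

Definition kernel_odd e x t : R :=
  kernel_const e x * expR (- (t ^+ 2 / 2)) *
  (Num.sqrt 2 * x / (2 * b) * odd_bessel (e * x ^+ 2 / 2) t).

Lemma segal_bargmann_kernel_slice q e x t : q ^+ 2 = qreal e ->
  segal_bargmann_kernel alpha (x *: q) t =
  qslice q (kernel_even e x t) (kernel_odd e x t).
Proof.
move=> qe; rewrite /segal_bargmann_kernel.
(* The exponent is real, so the quaternionic exponential becomes the real one. *)
have -> : - 2^-1 *: ((x *: q) ^+ 2 + qreal (t ^+ 2)) =
    qreal (- (e * x ^+ 2 / 2) + - (t ^+ 2 / 2)).
  rewrite [(x *: q) ^+ 2]expr2 qscalerAl qscalerAr -[q * q]expr2 qe /qreal.
  by rewrite !scalerA -scalerDl scalerA; congr (_ *: _); ring.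
rewrite qexp_real scalerA (L_dunkl_slice _ qe) /qreal qscalerAl mul1r.
have -> : e * (Num.sqrt 2 * t * x) ^+ 2 / 4 = e * x ^+ 2 / 2 * t ^+ 2.
  by rewrite !exprMn sqr_sqrtr//; field.
rewrite /qslice !scalerDr !scalerA expRD.
by congr (_ *: _ + _ *: _);
  rewrite /kernel_even /kernel_odd /kernel_const /even_bessel /odd_bessel; ring.
Qed.

(** The only Gaussian in [t] comes from the Segal-Bargmann kernel; together with the density of
    [mu_alpha] it forms exactly Weber's weight. *)
Lemma mu_density_weight t : mu_density alpha t * expR (- (t ^+ 2 / 2)) =
  (2 `^ b * Gamma b)^-1 * radial_weight b t.
Proof.
rewrite /mu_density /radial_weight /gaussian_power real_normK ?num_real//.
rewrite (_ : 2 * alpha + 1 = 2 * b - 1); last by ring.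
by rewrite mulrAC mulrC.
Qed.

Lemma measurable_mu_density : measurable_fun setT (mu_density alpha).
Proof.
apply: measurable_funM => //.
by apply: (measurableT_comp (measurable_powR _)); exact: normr_measurable.
Qed.

Lemma mu_density_ge0 t : 0 <= mu_density alpha t.
Proof. by rewrite divr_ge0 ?powR_ge0// mulr_ge0 ?powR_ge0// ltW// Gamma_gt0. Qed.

Definition weighted_L2 (f : R -> R) : Prop := measurable_fun setT f /\
  mu.-integrable setT (EFin \o (fun t => radial_weight b t * f t ^+ 2)).

Lemma weighted_L2_mul f g : weighted_L2 f -> weighted_L2 g ->
  mu.-integrable setT (EFin \o (fun t => radial_weight b t * (f t * g t))).
Proof.
move=> [mf fi] [mg gi].
have := has_integralD (integrable_has_integral fi) (integrable_has_integral gi).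
apply: le_has_integral.
  by apply: measurable_funM; [exact: measurable_radial_weight|exact: measurable_funM].
move=> t; rewrite normrM (ger0_norm (radial_weight_ge0 _ _)) -mulrDr.
rewrite ler_wpM2l ?radial_weight_ge0// normrM.
rewrite -(real_normK (num_real (f t))) -(real_normK (num_real (g t))).
have := sqr_ge0 (`|f t| - `|g t|); have := sqr_ge0 (`|f t| + `|g t|).
by nra.
Qed.

Lemma weighted_L2_1 : weighted_L2 (fun=> 1).
Proof.
split=> //; have [h _] := radial_moment 0 b_ge.
by move: h; congr (_.-integrable _ _); apply/funext => t /=; rewrite expr1n expr0.
Qed.

(** Weber's integral with [u = v] is the square norm. *)
Lemma weighted_L2_even v : weighted_L2 (even_bessel v).
Proof.
by split; [exact: measurable_bessel|have [] := weber_integral v v b_ge].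
Qed.

Let b1_ge : 2^-1 <= b + 1. Proof. by move: halpha; lra. Qed.

(** The two factors [t] are absorbed by the weight, so products of odd parts are Weber integrands
    for [b + 1]. *)
Lemma odd_bessel_weight u v t :
  radial_weight b t * (odd_bessel u t * odd_bessel v t) =
  weber_integrand (b + 1) u v t.
Proof. by rewrite /weber_integrand (radial_weightS _ b_ge) /odd_bessel; ring. Qed.

Lemma weighted_L2_odd v : weighted_L2 (odd_bessel v).
Proof.
split; first by apply: measurable_funM => //; exact: measurable_bessel.
have [h _] := weber_integral v v b1_ge.
move: h; congr (_.-integrable _ _); apply/funext => t /=.
by rewrite -odd_bessel_weight expr2.
Qed.

Lemma weighted_L2Z f c : weighted_L2 f -> weighted_L2 (fun t => c * f t).
Proof.
move=> [mf fi]; split; first exact: measurable_funM.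
have [h _] := has_integralZ (c ^+ 2) (integrable_has_integral fi).
move: h; congr (_.-integrable _ _); apply/funext => t /=.
by rewrite exprMn mulrCA.
Qed.

End dunkl_kernels.

(** * Measurability and integration of quaternion-valued functions *)

Section quaternion_valued_functions.
Context {R : realType}.
Implicit Types (alpha : R) (J q : quat R) (phi psi : R -> quat R).
Local Notation mu := (@lebesgue_measure R).

Lemma quat_measurableP phi :
  quat_measurable phi <-> forall n, (n < 4)%N -> measurable_fun setT (fun t => qc n (phi t)).
Proof.
split=> [h n n4|h i]; first exact: h.
by have := h i (ltn_ord i); rewrite /qc inord_val.
Qed.

Lemma quat_measurable_slice q (A B : R -> R) :
  measurable_fun setT A -> measurable_fun setT B ->
  quat_measurable (fun t => qslice q (A t) (B t)).
Proof.
move=> mA mB; apply/quat_measurableP => n n4.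
under eq_fun do rewrite qc_slice.
by apply: measurable_funD; exact: measurable_funM.
Qed.

Lemma quat_measurable_mul phi psi : quat_measurable phi -> quat_measurable psi ->
  quat_measurable (fun t => phi t * psi t).
Proof.
move=> /quat_measurableP mphi /quat_measurableP mpsi; apply/quat_measurableP.
have h m n : (m < 4)%N -> (n < 4)%N ->
    measurable_fun setT (fun t => qc m (phi t) * qc n (psi t)).
  by move=> m4 n4; apply: measurable_funM; [exact: mphi|exact: mpsi].
case=> [|[|[|[|//]]]] _; under eq_fun do rewrite qcM.
- by do 3 (apply: measurable_funB; last exact: h); exact: h.
- apply: measurable_funB; last exact: h.
  by do 2 (apply: measurable_funD; last exact: h); exact: h.
- apply: measurable_funD; last exact: h; apply: measurable_funD; last exact: h.
  by apply: measurable_funB; exact: h.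
- apply: measurable_funD; last exact: h.
  apply: measurable_funB; last exact: h.
  by apply: measurable_funD; exact: h.
Qed.

Lemma quat_measurable_conj phi : quat_measurable phi ->
  quat_measurable (fun t => qconj (phi t)).
Proof.
move=> /quat_measurableP m; apply/quat_measurableP.
case=> [|[|[|[|//]]]] _; under eq_fun do rewrite /qconj qc_mkquat; first exact: m.
all: by apply: measurableT_comp => //; exact: m.
Qed.

(** [D psi] is known only up to null sets; this permits replacing it under the integral. *)
Lemma mu_integral_ae alpha phi psi : - 2^-1 <= alpha ->
  quat_measurable phi -> quat_measurable psi -> eq_ae phi psi ->
  mu_integral alpha phi = mu_integral alpha psi.
Proof.
move=> halpha mphi mpsi pe; apply/rowP => i; rewrite !mxE; congr fine.
apply: ae_eq_integral => //.
- apply/measurable_EFinP; apply: measurable_funM; last exact: mphi.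
  exact: measurable_mu_density.
- apply/measurable_EFinP; apply: measurable_funM; last exact: mpsi.
  exact: measurable_mu_density.
- have [N [mN N0 subN]] := pe; exists N; split=> // t /= h; apply: subN => /= pt.
  by apply: h => _; rewrite pt.
Qed.

Lemma mu_integral_slice alpha q (A B : R -> R) a b :
  has_integral (fun t => mu_density alpha t * A t) a ->
  has_integral (fun t => mu_density alpha t * B t) b ->
  mu_integral alpha (fun t => qslice q (A t) (B t)) = qslice q a b.
Proof.
move=> hA hB; apply/rowP => i; rewrite mxE.
have := has_integralD (has_integralZ ((1 : quat R) ord0 i) hA) (has_integralZ (q ord0 i) hB).
move=> /has_integral_Rintegral; rewrite !mxE => h.
rewrite -mulrC -[X in _ = _ + X]mulrC -h; apply: eq_Rintegral => t _.
by rewrite !mxE; ring.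
Qed.

End quaternion_valued_functions.

(** * The slice Dunkl transform of the Segal-Bargmann kernel *)

Section dunkl_of_kernel.
Context {R : realType}.
Context (alpha : R) (halpha : - 2^-1 <= alpha).
Context (J : quat R) (hJ : imaginary_unit J).
Implicit Types (x s t : R).
Local Notation mu := (@lebesgue_measure R).
Local Notation b := (alpha + 1).

Let b_ge : 2^-1 <= b. Proof. by move: halpha; lra. Qed.
Let b1_ge : 2^-1 <= b + 1. Proof. by move: halpha; lra. Qed.
Let b_gt0 : 0 < b. Proof. by move: halpha; lra. Qed.

Let J2 : J ^+ 2 = qreal (- 1).
Proof. by rewrite /qreal scaleN1r; exact: hJ. Qed.

Let one2 : (1 : quat R) ^+ 2 = qreal 1.
Proof. by rewrite expr1n /qreal scale1r. Qed.

Let psi x t := segal_bargmann_kernel alpha (x *: J) t.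

Lemma segal_bargmann_kernel_imag x t : segal_bargmann_kernel alpha (x *: J) t =
  qslice J (kernel_even alpha (-1) x t) (kernel_odd alpha (-1) x t).
Proof. exact: segal_bargmann_kernel_slice. Qed.

Lemma segal_bargmann_kernel_real x t : segal_bargmann_kernel alpha (qreal x) t =
  qreal (kernel_even alpha 1 x t + kernel_odd alpha 1 x t).
Proof.
rewrite /qreal (segal_bargmann_kernel_slice halpha x t one2).
by rewrite /qslice scalerDl.
Qed.

Lemma qconj_segal_bargmann_kernel x t :
  qconj (segal_bargmann_kernel alpha (x *: J) t) =
  segal_bargmann_kernel alpha (- (x *: J)) t.
Proof.
rewrite -scaleNr !segal_bargmann_kernel_imag qconj_slice//.
by rewrite /kernel_even /kernel_odd /kernel_const sqrrN; congr qslice; ring.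
Qed.

Lemma measurable_kernel_even e x : measurable_fun setT (kernel_even alpha e x).
Proof.
apply: measurable_funM; last exact: measurable_bessel.
apply: measurable_funM => //; apply: measurableT_comp => //.
by apply: measurableT_comp => //; apply: measurable_funM => //; exact: measurable_funX.
Qed.

Lemma measurable_kernel_odd e x : measurable_fun setT (kernel_odd alpha e x).
Proof.
apply: measurable_funM.
  apply: measurable_funM => //; apply: measurableT_comp => //.
  by apply: measurableT_comp => //; apply: measurable_funM => //; exact: measurable_funX.
apply: measurable_funM => //; apply: measurable_funM => //.
exact: measurable_bessel.
Qed.

Lemma quat_measurable_kernel_imag x :
  quat_measurable (segal_bargmann_kernel alpha (x *: J)).
Proof.
rewrite (_ : segal_bargmann_kernel _ _ = fun t => qslice J (kernel_even alpha (-1) x t)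
  (kernel_odd alpha (-1) x t)); last by apply/funext; exact: segal_bargmann_kernel_imag.
by apply: quat_measurable_slice; [exact: measurable_kernel_even|exact: measurable_kernel_odd].
Qed.

Let kc x := kernel_const alpha (-1) x.
Let v x := - 1 * x ^+ 2 / 2.
Let d x := Num.sqrt 2 * x / (2 * b).

Let kc_ge0 x : 0 <= kc x.
Proof. by rewrite mulr_ge0 ?powR_ge0 ?expR_ge0. Qed.

(** One majorant for both norms: with [w] the sum of the two squares, [w <= 1 + w] gives the [L2]
    bound and [sqrt w <= 1 + w] the [L1] bound. *)
Let dominant x t := radial_weight b t *
  (1 + even_bessel alpha (v x) t ^+ 2 + (d x * odd_bessel alpha (v x) t) ^+ 2).

Let dominant_integrable x : mu.-integrable setT (EFin \o dominant x).
Proof.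
have [_ /integrable_has_integral h1] := weighted_L2_1 halpha.
have [_ /integrable_has_integral h2] := weighted_L2_even halpha (v x).
have [_ /integrable_has_integral h3] := weighted_L2Z (d x) (weighted_L2_odd halpha (v x)).
have [h _] := has_integralD (has_integralD h1 h2) h3.
move: h; congr (_.-integrable _ _); apply/funext => t /=.
by rewrite /dominant expr1n; congr EFin; ring.
Qed.

Let mu_density_kernelE (c : R) x t : 0 <= c ->
  mu_density alpha t * (c * expR (- (t ^+ 2 / 2)) *
    (1 + even_bessel alpha (v x) t ^+ 2 + (d x * odd_bessel alpha (v x) t) ^+ 2)) =
  c * (2 `^ b * Gamma b)^-1 * dominant x t.
Proof.
move=> c0; rewrite mulrA [_ * (c * _)]mulrCA mu_density_weight// /dominant; ring.
Qed.

Let qnorm_psi x t : qnorm (psi x t) ^+ 2 = (kc x * expR (- (t ^+ 2 / 2))) ^+ 2 *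
  (even_bessel alpha (v x) t ^+ 2 + (d x * odd_bessel alpha (v x) t) ^+ 2).
Proof.
rewrite /psi segal_bargmann_kernel_imag qnorm_slice// /kernel_even /kernel_odd.
by rewrite -/(v x) -/(d x) -/(kc x); ring.
Qed.

Let expn_le1 t : expR (- (t ^+ 2 / 2)) <= 1.
Proof. by rewrite -[leRHS]expR0 ler_expR oppr_le0 divr_ge0// sqr_ge0. Qed.

Let measurable_qnorm_psi x : measurable_fun setT (fun t => qnorm (psi x t)).
Proof.
rewrite (_ : (fun _ => _) = fun t => Num.sqrt (kernel_even alpha (-1) x t ^+ 2 +
    kernel_odd alpha (-1) x t ^+ 2)); last first.
  apply/funext => t; rewrite /psi segal_bargmann_kernel_imag -(qnorm_slice _ _ hJ).
  by rewrite sqrtr_sqr ger0_norm// sqrtr_ge0.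
apply: (measurableT_comp (continuous_measurable_fun (@sqrt_continuous R))).
apply: measurable_funD; apply: measurable_funX.
  exact: measurable_kernel_even.
exact: measurable_kernel_odd.
Qed.

Lemma segal_bargmann_kernel_L2 x : L2_mu alpha (segal_bargmann_kernel alpha (x *: J)).
Proof.
split; first exact: quat_measurable_kernel_imag.
apply: integrable_lty => //.
apply: (@le_has_integral _ _ (fun t => kc x ^+ 2 * (2 `^ b * Gamma b)^-1 * dominant x t)).
- apply: measurable_funM; last exact: measurable_mu_density.
  exact: measurable_funX (measurable_qnorm_psi x).
- move=> t; rewrite -mu_density_kernelE ?sqr_ge0// ger0_norm; last first.
    by rewrite mulr_ge0 ?sqr_ge0// mu_density_ge0.
  rewrite mulrC ler_wpM2l ?mu_density_ge0// -/(psi x t) qnorm_psi exprMn.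
  rewrite ler_pM ?mulr_ge0 ?sqr_ge0 ?addr_ge0 ?sqr_ge0//.
    rewrite ler_wpM2l ?sqr_ge0// expr2 ler_piMl ?expR_ge0//.
  by rewrite -addrA lerDr.
- exact: has_integralZ (integrable_has_integral (dominant_integrable x)).
Qed.

Lemma segal_bargmann_kernel_L1 x : L1_mu alpha (segal_bargmann_kernel alpha (x *: J)).
Proof.
split; first exact: quat_measurable_kernel_imag.
apply: integrable_lty => //.
apply: (@le_has_integral _ _ (fun t => kc x * (2 `^ b * Gamma b)^-1 * dominant x t)).
- apply: measurable_funM; last exact: measurable_mu_density.
  exact: measurable_qnorm_psi.
- move=> t; rewrite -mu_density_kernelE// ger0_norm; last first.
    by rewrite mulr_ge0 ?sqrtr_ge0// mu_density_ge0.
  rewrite mulrC ler_wpM2l ?mu_density_ge0// -/(psi x t).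
  have k0 : 0 <= kc x * expR (- (t ^+ 2 / 2)) by rewrite mulr_ge0 ?expR_ge0.
  have w0 : 0 <= even_bessel alpha (v x) t ^+ 2 +
      (d x * odd_bessel alpha (v x) t) ^+ 2 by rewrite addr_ge0 ?sqr_ge0.
  rewrite -addrA -ler_sqr ?nnegrE ?sqrtr_ge0//; last first.
    by rewrite mulr_ge0// (addr_ge0 ler01 w0).
  rewrite qnorm_psi [leRHS]exprMn ler_wpM2l ?sqr_ge0//.
  by move: w0; set w := _ + _ => w0; nra.
- exact: (has_integralZ (kc x * (2 `^ b * Gamma b)^-1)
    (integrable_has_integral (dominant_integrable x))).
Qed.

(** The product of the two slice expansions has real part [A], even in [t], and [J]-part [B], odd in
    [t]. Weber's formula at [b] and at [b + 1] evaluates the integral of [A]; that of [B] vanishes,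
    so the result is real. *)
Lemma dunkl_segal_bargmann_kernel x s :
  dunkl_integral alpha J (segal_bargmann_kernel alpha (x *: J)) s =
  segal_bargmann_kernel alpha (qreal x) s.
Proof.
pose u := - 1 * s ^+ 2 / 4.
pose A t := even_bessel alpha u t * kernel_even alpha (-1) x t +
  s / (2 * b) * odd_bessel alpha u t * kernel_odd alpha (-1) x t.
pose B t := even_bessel alpha u t * kernel_odd alpha (-1) x t -
  s / (2 * b) * odd_bessel alpha u t * kernel_even alpha (-1) x t.
rewrite /dunkl_integral (_ : (fun t => _) = fun t => qslice J (A t) (B t)); last first.
  apply/funext => t; rewrite segal_bargmann_kernel_imag (L_dunkl_slice halpha _ J2).
  rewrite qslice_mul// /A /B /even_bessel /odd_bessel.
  rewrite (_ : -1 * (- (s * t)) ^+ 2 / 4 = u * t ^+ 2); last by rewrite /u; ring.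
  by congr qslice; ring.
have hA : has_integral (fun t => mu_density alpha t * A t)
    (kernel_even alpha 1 x s + kernel_odd alpha 1 x s).
  have hAE := has_integralD (weber_integral u (v x) b_ge)
    (has_integralZ (s / (2 * b) * d x) (weber_integral u (v x) b1_ge)).
  rewrite (_ : kernel_even alpha 1 x s + kernel_odd alpha 1 x s =
      kc x * (2 `^ b * Gamma b)^-1 *
      (2 `^ b * Gamma b * (bessel b (4 * u * v x) * expR (2 * u + 2 * v x)) +
       s / (2 * b) * d x * (2 `^ (b + 1) * Gamma (b + 1) *
         (bessel (b + 1) (4 * u * v x) * expR (2 * u + 2 * v x))))).
    apply: eq_has_integral (has_integralZ _ hAE) => t.
    rewrite -odd_bessel_weight// /weber_integrand.
    rewrite -/(even_bessel alpha u t) -/(even_bessel alpha (v x) t).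
    rewrite /A /kernel_even /kernel_odd -/(v x) -/(d x) -/(kc x).
    transitivity (kc x * (mu_density alpha t * expR (- (t ^+ 2 / 2))) *
      (even_bessel alpha u t * even_bessel alpha (v x) t +
       s / (2 * b) * d x * (odd_bessel alpha u t * odd_bessel alpha (v x) t))).
      by rewrite mu_density_weight; ring.
    by ring.
  (* [2u + 2v = - s^2 / 2 - x^2] supplies the missing Gaussian in [s] and flips the sign of the
     exponent [x^2 / 2]. *)
  have e1 : expR (- (1 * x ^+ 2 / 2)) * expR (- (s ^+ 2 / 2)) =
      expR (- (-1 * x ^+ 2 / 2)) * expR (2 * u + 2 * v x).
    by rewrite -!expRD /u /v; congr expR; field.
  have e2 : 1 * x ^+ 2 / 2 * s ^+ 2 = 4 * u * v x by rewrite /u /v; field.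
  rewrite /kernel_even /kernel_odd /kc /kernel_const /even_bessel /odd_bessel e2.
  (* [2^(b+1) Gamma(b+1) = 2b * 2^b Gamma(b)], and this [2b] cancels the denominator of
     [s / (2b)]. *)
  have e3 : (2 : R) `^ (b + 1) = 2 `^ b * 2.
    by rewrite [LHS]powRD ?pnatr_eq0 ?implybT// powRr1.
  rewrite (GammaS b_ge) e3.
  transitivity (2 `^ (b / 2) * (expR (- (1 * x ^+ 2 / 2)) * expR (- (s ^+ 2 / 2))) *
    (bessel b (4 * u * v x) + d x * (s * bessel (b + 1) (4 * u * v x)))).
    by rewrite -/(d x); ring.
  rewrite e1.
  have G0 : Gamma b != 0 by rewrite gt_eqF// Gamma_gt0.
  have p0 : 2 `^ b != 0 :> R by rewrite gt_eqF// powR_gt0.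
  have b0 : b != 0 by rewrite gt_eqF.
  by rewrite /d; field; rewrite G0 p0 b0.
have hB : has_integral (fun t => mu_density alpha t * B t) 0.
  have mB : measurable_fun setT (fun t => mu_density alpha t * B t).
    apply: measurable_funM; first exact: measurable_mu_density.
    have [me _] := weighted_L2_even halpha u; have [mo _] := weighted_L2_odd halpha u.
    apply: measurable_funB; first exact: measurable_funM me (measurable_kernel_odd _ _).
    by apply: measurable_funM (measurable_kernel_even _ _); exact: measurable_funM.
  have BE t : mu_density alpha t * B t = kc x * (2 `^ b * Gamma b)^-1 *
     (d x * (radial_weight b t * (even_bessel alpha u t * odd_bessel alpha (v x) t))
      + - (s / (2 * b)) *
        (radial_weight b t * (odd_bessel alpha u t * even_bessel alpha (v x) t))).
    rewrite /B /kernel_even /kernel_odd -/(v x) -/(d x) -/(kc x).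
    transitivity (kc x * (mu_density alpha t * expR (- (t ^+ 2 / 2))) *
      (d x * (even_bessel alpha u t * odd_bessel alpha (v x) t)
       - s / (2 * b) * (odd_bessel alpha u t * even_bessel alpha (v x) t))).
      by ring.
    by rewrite mu_density_weight; ring.
  rewrite -[X in has_integral _ X](Rintegral_odd mB).
    apply: integrable_has_integral.
    have i1 := weighted_L2_mul (weighted_L2_even halpha u) (weighted_L2_odd halpha (v x)).
    have i2 := weighted_L2_mul (weighted_L2_odd halpha u) (weighted_L2_even halpha (v x)).
    have [h _] := has_integralZ (kc x * (2 `^ b * Gamma b)^-1) (has_integralD
      (has_integralZ (d x) (integrable_has_integral i1))
      (has_integralZ (- (s / (2 * b))) (integrable_has_integral i2))).
    by move: h; congr (_.-integrable _ _); apply/funext => t /=; rewrite BE.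
  move=> t; rewrite !BE /radial_weight normrN /even_bessel /odd_bessel sqrrN; ring.
rewrite (mu_integral_slice J hA hB) segal_bargmann_kernel_real.
by rewrite /qslice scale0r addr0.
Qed.

End dunkl_of_kernel.

Theorem proposition4p10 (R : realType) (alpha : R) (halpha : - 2^-1 <= alpha)
  (J : quat R) (hJ : imaginary_unit J)
  (D : (R -> quat R) -> (R -> quat R)) (hD : is_slice_dunkl alpha J D)
  (Tinv : (quat R -> quat R) -> (R -> quat R))
  (hTinv : is_segal_bargmann_inverse alpha Tinv)
  (f : quat R -> quat R) (hf : slice_fock alpha f) (x : R) :
  segal_bargmann alpha (D (Tinv f)) (qreal x) = f (- (x *: J)).
Proof.
have [[D_L2 _ D_dot _] D_int] := hD.
have [phi_L2 <-] := hTinv.1 f hf; set phi := Tinv f in phi_L2 *.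
pose psi := segal_bargmann_kernel alpha (x *: J).
have psi_L2 : L2_mu alpha psi := segal_bargmann_kernel_L2 halpha hJ x.
have psi_L1 : L1_mu alpha psi := segal_bargmann_kernel_L1 halpha hJ x.
have [mDphi _] := D_L2 _ phi_L2; have [mDpsi _] := D_L2 _ psi_L2.
transitivity (L2_dot alpha (D phi) (D psi)).
  apply: mu_integral_ae => //.
  - apply: quat_measurable_mul => //.
    (* At a real point the kernel is real, hence a slice expression with [q = 0]. *)
    rewrite (_ : segal_bargmann_kernel _ _ = fun t =>
        qslice 0 (kernel_even alpha 1 x t + kernel_odd alpha 1 x t) 0); last first.
      apply/funext => t; rewrite segal_bargmann_kernel_real//.
      by rewrite /qslice scale0r addr0.
    apply: quat_measurable_slice => //; apply: measurable_funD.
      exact: measurable_kernel_even.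
    exact: measurable_kernel_odd.
  - by apply: quat_measurable_mul => //; exact: quat_measurable_conj.
  (* Off the null set where [D psi] differs from its integral formula, the conjugate of [D psi] is
     the real kernel itself. *)
  - have [N [mN N0 subN]] := D_int _ psi_L1 psi_L2.
    exists N; split=> // t /= h; apply: subN => /= e; apply: h.
    rewrite e dunkl_segal_bargmann_kernel// segal_bargmann_kernel_real//.
    by rewrite qconj_real.
rewrite D_dot// /segal_bargmann /L2_dot; congr mu_integral.
by apply/funext => t; rewrite qconj_segal_bargmann_kernel.
Qed.
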